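(* Suppose the billiard boundary is of class $\mathcal{C}^3$, and let $P^3$ be the set of three-period orbits of the billiard map. Then the Hausdorff dimension of $P^3$ is not more than one, i.e., $\mathcal{H}^s(P^3)=0$ for every $s>1$.
   Context: Billiard setting: consider a (classical, planar) billiard whose boundary is a closed curve of length $l$, not necessarily convex, parametrized by arc length $t$; the parameter circle $\mathbb{R}/l\mathbb{Z}$ is denoted $S^1$. An outgoing trajectory is described by $(t,\theta)$, where $t$ is the boundary point it leaves from and $\theta\in I=(0,\pi)$ is the angle it makes with the tangent to the boundary there. The billiard map $T$ sends $(t_1,\theta_1)$ to $(t_2,\theta_2)$, where $t_2$ is the next boundary point hit by the trajectory and $\theta_2$ is the angle with the tangent of the trajectory leaving $t_2$ after reflection (angle of incidence equals angle of reflection). It is defined for segments that are transversal to the boundary at both ends; the segments that are not transversal are disregarded. The phase space is the open annulus $U=S^1\times I$, which may be regarded as smoothly embedded in the plane $\mathbb{R}^2$. The set $P^3\subseteq U$ of three-period orbits is the set of points $p=(t,\theta)\in U$ with $T^3(p)=p$. Hausdorff measure: for $E\subseteq\mathbb{R}^2$, $0\le s<\infty$ and $\delta>0$, $\mathcal{H}^s_\delta(E)=\inf\sum_{i}\operatorname{diam}(U_i)^s$, the infimum over all countable covers $\{U_i\}$ of $E$ with $0<\operatorname{diam}(U_i)\le\delta$, and $\mathcal{H}^s(E)=\lim_{\delta\to0+}\mathcal{H}^s_\delta(E)$. The Hausdorff dimension of $E$ is the unique $s_0$ such that $\mathcal{H}^s(E)=\infty$ for $0\le s<s_0$ and $\mathcal{H}^s(E)=0$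 for $s>s_0$. *)

(* Defs.v *)
From HB Require Import structures.
From mathcomp Require Import all_boot all_order all_algebra.
From mathcomp Require Import all_classical all_reals all_analysis.

Set Implicit Arguments.
Unset Strict Implicit.
Unset Printing Implicit Defensive.

Import Order.TTheory GRing.Theory Num.Theory.
Import numFieldNormedType.Exports.

Local Open Scope classical_set_scope.
Local Open Scope ring_scope.

(* The norm that the library puts on R * R is the sup norm: the Euclidean
   structure of the plane is therefore given explicitly. Topological notions
   (open, closure, connected, bounded) do not depend on this choice. *)
Definition dotp {R : realType} (u v : R * R) : R := u.1 * v.1 + u.2 * v.2.

Definition edist {R : realType} (p q : R * R) : R :=
  Num.sqrt (dotp (p - q) (p - q)).

(* -oo on the empty set *)
Definition diam {R : realType} (E : set (R * R)) : \bar R :=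
  ereal_sup [set (edist p q)%:E | p in E & q in E].

(* The index set J is an arbitrary subset of nat, so that finite covers are
   allowed although all the diameters have to be positive. *)
Definition hausdorff_cover {R : realType} (delta : R) (E : set (R * R))
    (J : set nat) (C : nat -> set (R * R)) : Prop :=
  E `<=` \bigcup_(i in J) C i /\
  (forall i, J i -> (0 < diam (C i))%E /\ (diam (C i) <= delta%:E)%E).

Definition hausdorff_premeasure {R : realType} (s delta : R)
    (E : set (R * R)) : \bar R :=
  ereal_inf [set z | exists (J : set nat) (C : nat -> set (R * R)),
    hausdorff_cover delta E J C /\ z = esum J (fun i => poweR (diam (C i)) s)].

Definition hausdorff_measure {R : realType} (s : R) (E : set (R * R)) : \bar R :=
  lim (hausdorff_premeasure s delta E @[delta --> 0^'+]).

Definition is_hausdorff_dim {R : realType} (E : set (R * R)) (s0 : R) : Prop :=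
  [/\ 0 <= s0,
      forall s, 0 <= s -> s < s0 -> hausdorff_measure s E = +oo%E &
      forall s, s0 < s -> hausdorff_measure s E = 0%E].

Definition class_C {R : realType} (k : nat) (f : R -> R) : Prop :=
  (forall n, (n < k)%N -> forall t, derivable (derive1n n f) t 1) /\
  continuous (derive1n k f).

Definition class_C_curve {R : realType} (k : nat) (gamma : R -> R * R) : Prop :=
  class_C k (fst \o gamma) /\ class_C k (snd \o gamma).

Definition tangent {R : realType} (gamma : R -> R * R) (t : R) : R * R :=
  (derive1 (fst \o gamma) t, derive1 (snd \o gamma) t).

(* D is the table, i.e. the bounded domain enclosed by the simple closed curve
   gamma, given as an l-periodic function of the arc length. Both orientations
   of gamma are allowed. *)
Record billiard {R : realType} (l : R) (gamma : R -> R * R)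
    (D : set (R * R)) : Prop := Billiard {
  billiard_length_gt0 : 0 < l;
  billiard_periodic : forall t, gamma (t + l) = gamma t;
  billiard_simple : forall t t', gamma t = gamma t' ->
    exists k : int, t' = t + k%:~R * l;
  billiard_derivable : forall t,
    derivable (fst \o gamma) t 1 /\ derivable (snd \o gamma) t 1;
  billiard_arclength : forall t, dotp (tangent gamma t) (tangent gamma t) = 1;
  billiard_open : open D;
  billiard_connected : connected D;
  billiard_bounded : bounded_set D;
  billiard_boundary : closure D `\` D = range gamma
}.

(* A point of the phase space U = (R / l Z) x ]0, pi[ is represented by any of
   its lifts (t, theta) in R x ]0, pi[. *)
Definition phase {R : realType} (p : R * R) : Prop := 0 < p.2 /\ p.2 < pi.

(* v is the unit vector that leaves gamma t into the table D and makes with the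
   tangent at t the (unoriented) angle theta, where p = (t, theta). *)
Definition outgoing {R : realType} (gamma : R -> R * R) (D : set (R * R))
    (p v : R * R) : Prop :=
  [/\ phase p,
      dotp v v = 1,
      dotp v (tangent gamma p.1) = cos p.2 &
      exists2 e : R, 0 < e &
        forall r : R, 0 < r -> r < e -> D (gamma p.1 + r *: v)].

(* Image of v under the orthogonal reflection in the line spanned by the unit
   vector w. *)
Definition reflection {R : realType} (w v : R * R) : R * R :=
  (2 * dotp v w) *: w - v.

(* The billiard map is partial, hence encoded by its graph. The trajectory runs
   from gamma p.1 to its next point on the boundary, gamma q.1; [phase] at both
   ends excludes the segments that are not transversal to the boundary. *)
Definition billiard_map {R : realType} (gamma : R -> R * R) (D : set (R * R))
    (p q : R * R) : Prop :=
  exists (v : R * R) (L : R),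
    [/\ outgoing gamma D p v,
        0 < L,
        gamma q.1 = gamma p.1 + L *: v,
        (forall r : R, 0 < r -> r < L -> ~ range gamma (gamma p.1 + r *: v)) &
        outgoing gamma D q (reflection (tangent gamma q.1) v)].

Definition period3 {R : realType} (gamma : R -> R * R) (D : set (R * R)) :
    set (R * R) :=
  [set p | exists q r : R * R,
    [/\ billiard_map gamma D p q, billiard_map gamma D q r &
        billiard_map gamma D r p]].

(* Smooth, bi-Lipschitz embedding of the annulus (R / l Z) x ]0, pi[ in the
   plane, with image 1 < |z| < 1 + pi. *)
Definition annulus_embedding {R : realType} (l : R) (p : R * R) : R * R :=
  ((1 + p.2) * cos (2 * pi * p.1 / l), (1 + p.2) * sin (2 * pi * p.1 / l)).

(* Main.v *)
From mathcomp Require Import all_boot all_order all_algebra.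
From mathcomp Require Import all_classical all_reals all_analysis.
From mathcomp Require Import ring lra.
Require Import Defs.
Import Order.TTheory GRing.Theory Num.Theory.
Import numFieldNormedType.Exports.

Set Implicit Arguments.
Unset Strict Implicit.
Unset Printing Implicit Defensive.

Local Open Scope classical_set_scope.
Local Open Scope ring_scope.

(* A 3-periodic orbit is determined by the triple (t0, t1, t2) of its bounce
   points, which is a critical point of the perimeter P of the inscribed
   triangle. Let C_ij and S_ij be the cosine and sine of the angle from the
   tangent at t_i to the chord from t_i to t_j, k the curvature at t0, and
   K = k P - 2 S_01^3. The Hessian H of P has nonzero off-diagonal entries, and
   its minor with rows 0, 1 and columns 0, 2 is a nonzero multiple of K.
   - Where K <> 0, the gradients of two components of dP are independent, so
     the critical set is locally a Lipschitz graph over the t1-axis.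
   - Where K = 0, the critical point equation for t0 is differentiated along
     with K itself: dP = 0 makes the derivative of K in t2 vanish, while its
     derivative in t1 is a nonzero multiple of C_01, and C_01 <> 0 because
     at a right angle the two sides that meet at t0 would overlap. Hence the
     zeros of K in the critical set are locally a Lipschitz graph over the
     t0-axis.
   Strict differentiability replaces the implicit function theorem, and
   countably many Lipschitz graphs over intervals are null for s > 1.
   The geometry enters through the fact that the outgoing unit vector is
   determined by (t, theta), i.e. that the table lies on one side of its
   boundary: which sides belong to the table is locally constant along the
   curve, and at a rightmost point one of them is outside. *)

(** * Hausdorff null sets in the plane *)

Section Plane.
Context {R : realType}.
Implicit Types p q r : R * R.

Lemma edistE p q :
  edist p q = Num.sqrt ((p.1 - q.1) ^+ 2 + (p.2 - q.2) ^+ 2).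
Proof. by rewrite /edist /dotp /= -!expr2. Qed.

Lemma sqrtr_le_sqr (a b : R) : 0 <= b -> a <= b ^+ 2 -> Num.sqrt a <= b.
Proof.
move=> b0 ab; rewrite -(ger0_norm b0) -sqrtr_sqr.
exact: ler_wsqrtr.
Qed.

Lemma edist_le_sum p q : edist p q <= `|p.1 - q.1| + `|p.2 - q.2|.
Proof.
rewrite edistE; apply: sqrtr_le_sqr; first exact: addr_ge0.
rewrite [leRHS]sqrrD !real_normK ?num_real// lerD2r lerDl mulrn_wge0//.
Qed.

Lemma minkowski2 (a b c d : R) :
  Num.sqrt ((a + c) ^+ 2 + (b + d) ^+ 2) <=
  Num.sqrt (a ^+ 2 + b ^+ 2) + Num.sqrt (c ^+ 2 + d ^+ 2).
Proof.
have ab0 : 0 <= a ^+ 2 + b ^+ 2 by rewrite addr_ge0 ?sqr_ge0.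
have cd0 : 0 <= c ^+ 2 + d ^+ 2 by rewrite addr_ge0 ?sqr_ge0.
apply: sqrtr_le_sqr; first by rewrite addr_ge0 ?sqrtr_ge0.
rewrite !sqrrD !sqr_sqrtr// -sqrtrM//.
suff : a * c + b * d <= Num.sqrt ((a ^+ 2 + b ^+ 2) * (c ^+ 2 + d ^+ 2)).
  by rewrite !mulr2n; lra.
apply: (le_trans (ler_norm _)); rewrite -sqrtr_sqr ler_wsqrtr//.
have := sqr_ge0 (a * d - b * c); nra.
Qed.

Lemma edist_triangle q p r : edist p r <= edist p q + edist q r.
Proof.
rewrite !edistE; apply: le_trans (minkowski2 _ _ _ _).
by rewrite !(addrA _ _ (- _)) !subrK.
Qed.

Lemma edistC p q : edist p q = edist q p.
Proof.
by rewrite !edistE -[X in X ^+ 2 + _]opprB sqrrN -[X in _ + X ^+ 2]opprB sqrrN.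
Qed.

Lemma edistpp p : edist p p = 0.
Proof. by rewrite edistE !subrr expr0n addr0 sqrtr0. Qed.

(** Covers must consist of sets of positive diameter. Closed balls serve for this, with a horizontal
    translate of the centre giving the lower bound. *)
Lemma diam_ball p (rho : R) : 0 < rho ->
  (rho%:E <= diam [set q | (edist p q <= rho)%R] <= (2 * rho)%:E)%E.
Proof.
move=> rho0; apply/andP; split.
  apply: ereal_sup_ubound; exists p; first by rewrite /= edistpp ltW.
  have d : edist p (p + (rho, 0)) = rho.
    rewrite edistE /= [X in X ^+ 2](_ : _ = - rho); last by ring.
    rewrite [X in _ + X ^+ 2](_ : _ = 0); last by ring.
    by rewrite expr0n addr0 sqrrN sqrtr_sqr gtr0_norm.
  by exists (p + (rho, 0)); rewrite /= ?d.
apply: ge_ereal_sup => _ [x /= px] [y /= py] <-; rewrite lee_fin.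
by apply: (le_trans (edist_triangle p _ _)); rewrite edistC; lra.
Qed.

End Plane.

(** * Hausdorff null sets and the dimension bound *)

Section HausdorffNull.
Context {R : realType}.
Implicit Types (s t : R) (E : set (R * R)).

(** Working form of measure zero: it involves neither an infimum nor a limit in [delta], and
    countable unions reduce to splitting [eps]. *)
Definition hausdorff_null s E := forall delta eps : R, 0 < delta -> 0 < eps ->
  exists (J : set nat) C, hausdorff_cover delta E J C /\
    (esum J (fun i => poweR (diam (C i)) s) <= eps%:E)%E.

Lemma hausdorff_measure_null s E :
  hausdorff_null s E -> hausdorff_measure s E = 0%E.
Proof.
move=> nE; apply: lim_near_cst => //.
near=> d.
have d0 : 0 < d by near: d; exact: nbhs_right_gt.
apply/eqP; rewrite eq_le; apply/andP; split.
  apply/lee_addgt0Pr => e e0; rewrite add0e.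
  have [J [C [cov le]]] := nE d e d0 e0.
  apply: ge_ereal_inf; exists (esum J (fun i => poweR (diam (C i)) s)) => //.
  by exists J, C.
apply: le_ereal_inf_tmp => _ [J [C [cov ->]]].
by apply: esum_ge0 => i _; exact: poweR_ge0.
Unshelve. all: by end_near. Qed.

(** In a cover by sets of diameter at most [b], each [t]-th power is at most [b ^ (t - s)] times the
    [s]-th power, so bounded [s]-sums give small [t]-sums. *)
Lemma hausdorff_null_gt (M : R) s t E : s < t ->
  (forall delta : R, 0 < delta -> exists (J : set nat) C,
    hausdorff_cover delta E J C /\
    (esum J (fun i => poweR (diam (C i)) s) <= M%:E)%E) ->
  hausdorff_null t E.
Proof.
move=> st bE d e d0 e0.
set N := `|M| + 1.
have N0 : 0 < N by rewrite ltr_wpDl.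
(* Chosen so that [b ^ (t - s) = e / N]; the summand 1 in [N] keeps the divisor positive. *)
set b := (e / N) `^ (t - s)^-1.
have b0 : 0 < b by rewrite powR_gt0 ?divr_gt0.
have m0 : 0 < Num.min d b by rewrite lt_min d0.
have [J [C [[EC dC] le]]] := bE _ m0.
exists J, C; split.
  split=> // i /dC[? le']; split=> //; apply: le_trans le' _.
  by rewrite lee_fin ge_min lexx.
have eN0 : 0 <= e / N by rewrite ltW// divr_gt0.
have step i : J i ->
    (poweR (diam (C i)) t <= (e / N)%:E * poweR (diam (C i)) s)%E.
  move=> /dC[]; case: (diam (C i)) => [r|//|//]; rewrite lte_fin lee_fin.
  move=> r0; rewrite le_min => /andP[_ rb].
  rewrite !poweR_EFin -EFinM lee_fin.
  have -> : r `^ t = r `^ (t - s) * r `^ s.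
    by rewrite -powRD ?subrK//; apply/implyP => _; rewrite gt_eqF.
  rewrite ler_wpM2r ?powR_ge0//.
  have -> : e / N = b `^ (t - s).
    by rewrite /b -powRrM mulVf ?powRr1// gt_eqF// subr_gt0.
  by rewrite ge0_ler_powR ?nnegrE ?subr_ge0 ?(ltW st) ?(ltW r0) ?(ltW b0).
apply: (le_trans (le_esum step)).
apply: (@le_trans _ _ ((e / N)%:E * esum J (fun i => poweR (diam (C i)) s))%E).
  apply: ge_ereal_sup => _ [F [finF FJ] <-].
  rewrite -ge0_mule_fsumr; last by move=> i; exact: poweR_ge0.
  rewrite lee_wpmul2l ?lee_fin//.
  by apply: ereal_sup_ubound; exists F.
apply: (@le_trans _ _ ((e / N)%:E * M%:E)%E).
  by rewrite lee_wpmul2l ?lee_fin.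
rewrite -EFinM lee_fin mulrAC ler_pdivrMr// ler_pM2l//.
by rewrite /N (le_trans (ler_norm _))// lerDl.
Qed.

Lemma hausdorff_null_lt s t E :
  s < t -> hausdorff_null s E -> hausdorff_null t E.
Proof.
by move=> st nE; apply: (@hausdorff_null_gt 1 s t) => // d d0; exact: nE.
Qed.

Lemma hausdorff_premeasure_noninc s E :
  {homo hausdorff_premeasure s ^~ E : d d' / d <= d' >-> (d' <= d)%E}.
Proof.
move=> d d' dd'; apply: le_ereal_inf => _ [J [C [[EC dC] ->]]].
exists J, C; split=> //; split=> // i /dC[? le]; split=> //.
by apply: (le_trans le); rewrite lee_fin.
Qed.

(** The premeasure decreases as [delta] grows, so its right limit at 0 is a supremum, of which the
    value at [delta] is a member. *)
Lemma hausdorff_premeasure_le s (delta : R) E : 0 < delta ->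
  (hausdorff_premeasure s delta E <= hausdorff_measure s E)%E.
Proof.
move=> d0; rewrite /hausdorff_measure.
have := @nonincreasing_at_right_cvge R (hausdorff_premeasure s ^~ E) 0
  (BRight delta).
rewrite bnd_simp => /(_ d0) h.
rewrite (cvg_lim _ (h _))//; last first.
  by move=> x y _ _; exact: hausdorff_premeasure_noninc.
apply: ereal_sup_ubound; exists delta => //=.
by rewrite in_itv /= d0 lexx.
Qed.

Lemma hausdorff_measure_fin_null s t E : s < t ->
  (hausdorff_measure s E < +oo)%E -> hausdorff_null t E.
Proof.
move=> st mE.
have [M mM] : exists M : R, (hausdorff_measure s E < M%:E)%E.
  case: (hausdorff_measure s E) mE => [r|//|] _; last by exists 0; rewrite ltNyr.
  by exists (r + 1); rewrite lte_fin ltrDl.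
apply: (@hausdorff_null_gt M s) => // d d0.
have := le_lt_trans (hausdorff_premeasure_le s E d0) mM.
by move=> /ereal_inf_lt[_ [J [C [cov ->]]] /ltW le]; exists J, C.
Qed.

(** The dimension is the infimum of the exponents at which [E] is null. A finite measure at some [s]
    below it would make [E] null at every exponent above [s], against the choice of the infimum. *)
Lemma hausdorff_dim_le1 E : (forall s, 1 < s -> hausdorff_null s E) ->
  exists2 s0, is_hausdorff_dim E s0 & s0 <= 1.
Proof.
move=> nE; pose S := [set s | 0 <= s /\ hausdorff_null s E].
have S0 : S !=set0 by exists 2; split; [lra|apply: nE; lra].
have lbS : lbound S 0 by move=> s [].
have infS s : S s -> inf S <= s by apply: ge_inf; exists 0.
exists (inf S); last first.
  apply/ler_addgt0Pr => e e0; apply: infS; split; first lra.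
  by apply: nE; lra.
split; first exact: lb_le_inf.
- move=> s s0 sS; apply/eqP/negPn/negP => mE.
  suff : inf S <= s by rewrite leNgt sS.
  apply/ler_addgt0Pr => e e0; apply: infS; split; first lra.
  apply: (@hausdorff_measure_fin_null s); first by rewrite ltrDl.
  by rewrite ltey.
- move=> s /(inf_lt S0)[t [t0 nt] ts].
  by apply: hausdorff_measure_null; exact: (hausdorff_null_lt ts).
Qed.

Lemma hausdorff_null_subset s E E' :
  E `<=` E' -> hausdorff_null s E' -> hausdorff_null s E.
Proof.
move=> EE' nE d e d0 e0; have [J [C [[EC dC] le]]] := nE d e d0 e0.
by exists J, C; split=> //; split=> // x /EE'/EC.
Qed.

(** The [n]-th set receives the share [e / 2 ^ (n + 1)] of the error, and the doubly indexed family
    of covers is renumbered by [nat] through [pickle]. *)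
Lemma hausdorff_null_bigcup s (E : nat -> set (R * R)) :
  (forall n, hausdorff_null s (E n)) -> hausdorff_null s (\bigcup_n E n).
Proof.
move=> nE d e d0 e0.
have en0 n : 0 < e / (2 ^ n.+1)%:R by rewrite divr_gt0// ltr0n expn_gt0.
have /choice[JC hJC] : forall n, exists JC : set nat * (nat -> set (R * R)),
    hausdorff_cover d (E n) JC.1 JC.2 /\
    (esum JC.1 (fun i => poweR (diam (JC.2 i)) s) <=
      (e / (2 ^ n.+1)%:R)%:E)%E.
  by move=> n; have [J [C h]] := nE n d _ d0 (en0 n); exists (J, C).
pose P : set (nat * nat) := setT `*`` (fun n => (JC n).1).
pose dec (k : nat) : nat * nat := odflt (0%N, 0%N) (unpickle k).
have decK : cancel pickle dec by move=> x; rewrite /dec pickleK.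
exists (pickle @` P), (fun k => (JC (dec k).1).2 (dec k).2); split; first split.
- move=> x [n _ Ex]; have [[sub _] _] := hJC n.
  have [i Ji Ci] := sub _ Ex.
  by exists (pickle (n, i)); [exists (n, i)|rewrite decK].
- move=> _ [[n i] [_ /= Ji] <-]; rewrite decK /=.
  by have [[_ h] _] := hJC n; exact: h.
rewrite (@reindex_esum _ _ _ P _ pickle); last first.
  split; [by move=> x Px /=; exists x| |by move=> _ [x Px <-]; exists x].
  by move=> x y _ _ /(congr1 dec); rewrite !decK.
rewrite (eq_esum (b := fun k => poweR (diam ((JC k.1).2 k.2)) s)); last first.
  by move=> k _; rewrite decK.
rewrite -(@esum_esum _ _ _ setT (fun n => (JC n).1)
  (fun n i => poweR (diam ((JC n).2 i)) s)); last by move=> *; exact: poweR_ge0.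
apply: (@le_trans _ _ (\esum_(n in [set: nat]) (e / (2 ^ n.+1)%:R)%:E)%E).
  by apply: le_esum => n _; have [] := hJC n.
rewrite -nneseries_esumT; last by move=> n; rewrite lee_fin ltW.
exact: epsilon_trick0 (ltW e0).
Qed.

(** The pieces [A i] may be empty or single points, hence inadmissible in a cover. Each is replaced
    by a closed ball of radius [rho] about one of its points, of diameter between [rho] and
    [2 * rho]. *)
Lemma hausdorff_null_finite_cover s E :
  (forall delta eps : R, 0 < delta -> 0 < eps ->
    exists (n : nat) (rho : R) (A : nat -> set (R * R)),
    [/\ 0 < rho, 2 * rho <= delta, n%:R * (2 * rho) `^ s <= eps,
      E `<=` \bigcup_(i in `I_n) A i &
      forall i x y, A i x -> A i y -> edist x y <= rho]) ->
  0 <= s -> hausdorff_null s E.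
Proof.
move=> fE s0 d e d0 e0; have [n [rho [A [rho0 rhod le EA dA]]]] := fE d e d0 e0.
have /choice[c hc] : forall i, exists c, A i !=set0 -> A i c.
  move=> i; have [[c ?]|?] := pselect (A i !=set0); first by exists c.
  by exists (0, 0).
exists `I_n, (fun i => [set q | edist (c i) q <= rho]); split; first split.
- move=> x /EA[i ni Ax]; exists i => //=; apply: (dA i) => //.
  by apply: hc; exists x.
- move=> i _; have /andP[le1 le2] := diam_ball (c i) rho0; split.
    by apply: lt_le_trans le1; rewrite lte_fin.
  by apply: (le_trans le2); rewrite lee_fin.
rewrite esum_fset//; last by move=> *; exact: poweR_ge0.
apply: (@le_trans _ _ (\sum_(i \in `I_n) ((2 * rho) `^ s)%:E)%E).
  apply: lee_fsum => // i _; have /andP[le1 le2] := diam_ball (c i) rho0.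
  move: le1 le2; case: (diam _) => [r|//|//]; rewrite !lee_fin => le1 le2.
  rewrite ge0_ler_powR ?nnegrE//; first exact: (le_trans (ltW rho0)).
  by rewrite mulr_ge0// ltW.
by rewrite -fsbig_ord sumEFin sumr_const card_ord lee_fin -[_ *+ n]mulr_natl.
Qed.

End HausdorffNull.

(** * Lipschitz graphs are null above dimension one *)

Section LipschitzNull.
Context {R : realType}.
Implicit Types s : R.

(** Cutting the range of [h] into [n] intervals of length [w / n] cuts the image into [n] pieces of
    diameter at most [K * w / n]. With [c = 2 * K * w] the total weight is [c * (c / n) ^ (s - 1)],
    which tends to 0 since [s > 1]. *)
Lemma hausdorff_null_lipschitz (X : Type) (S : set X) (h : X -> R)
    (F : X -> R * R) (a w K s : R) : 1 < s -> 0 < w -> 0 < K ->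
  (forall u, S u -> a <= h u < a + w) ->
  (forall u v, S u -> S v -> edist (F u) (F v) <= K * `|h u - h v|) ->
  hausdorff_null s (F @` S).
Proof.
move=> s1 w0 K0 hS FS; apply: hausdorff_null_finite_cover; last lra.
move=> d e d0 e0; set c := 2 * (K * w).
have c0 : 0 < c by rewrite !mulr_gt0.
set b := (e / c) `^ (s - 1)^-1.
have b0 : 0 < b by rewrite powR_gt0 ?divr_gt0.
have m0 : 0 < Num.min d b by rewrite lt_min d0.
(* Large enough for the mesh [c / n] to be below [d], as the cover requires, and below [b], which
   brings the weight under [e]. *)
set n := (Num.truncn (c / Num.min d b)).+1.
have n0 : 0 < n%:R :> R by rewrite ltr0n.
have cn : c / n%:R <= Num.min d b.
  rewrite ler_pdivrMr// mulrC -ler_pdivrMr// ltW//.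
  by have /andP[] := truncn_itv (divr_ge0 (ltW c0) (ltW m0)).
have rhoE : 2 * (K * w / n%:R) = c / n%:R by rewrite /c !mulrA.
pose idx u := Num.truncn ((h u - a) / w * n%:R).
have idxP u : S u -> (idx u)%:R <= (h u - a) / w * n%:R < (idx u).+1%:R.
  move=> /hS/andP[au _]; apply: truncn_itv.
  by rewrite mulr_ge0 ?divr_ge0 ?subr_ge0// ltW.
exists n, (K * w / n%:R), (fun i => F @` (S `&` [set u | idx u = i])); split.
- by rewrite divr_gt0 ?mulr_gt0.
- by rewrite rhoE (le_trans cn)// ge_min lexx.
- rewrite rhoE.
  have cn0 : 0 <= c / n%:R by rewrite ltW// divr_gt0.
  have ec0 : 0 <= e / c by rewrite ltW// divr_gt0.
  have -> : s = 1 + (s - 1) by ring.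
  rewrite powRD; last by apply/implyP => _; rewrite gt_eqF ?divr_gt0.
  rewrite powRr1// mulrA [n%:R * _]mulrC divfK ?gt_eqF//.
  apply: (@le_trans _ _ (c * b `^ (s - 1))).
    rewrite ler_pM2l// ge0_ler_powR ?nnegrE ?subr_ge0 ?(ltW s1) ?(ltW b0)//.
    by rewrite (le_trans cn)// ge_min lexx orbT.
  rewrite /b -powRrM mulVf ?gt_eqF ?subr_gt0// powRr1//.
  by rewrite mulrC divfK ?gt_eqF.
- move=> _ [u Su <-]; exists (idx u); last by exists u.
  rewrite /= -(ltr_nat R); have /andP[le _] := idxP u Su.
  apply: (le_lt_trans le); rewrite -[ltRHS]mul1r ltr_pM2r// ltr_pdivrMr//.
  by rewrite mul1r; have /andP[_] := hS u Su; lra.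
- move=> i _ _ [u [Su ui] <-] [v [Sv vi] <-].
  apply: (le_trans (FS _ _ Su Sv)); rewrite -mulrA ler_pM2l//.
  have := idxP u Su; have := idxP v Sv; rewrite ui vi.
  set x := (h u - a) / w * n%:R; set y := (h v - a) / w * n%:R.
  have -> : h u - h v = (x - y) * (w / n%:R).
    by rewrite /x /y; field; rewrite !gt_eqF.
  move=> /andP[y1 y2] /andP[x1 x2].
  rewrite normrM [X in _ * X]gtr0_norm ?divr_gt0//.
  rewrite -[leRHS]mul1r ler_pM2r ?divr_gt0// ler_norml.
  move: x2 y2; rewrite -addn1 natrD => x2 y2.
  apply/andP; split; lra.
Qed.

Lemma hausdorff_null_local_graph (n : nat) (E : set 'rV[R]_n)
    (F : 'rV[R]_n -> R * R) s : 1 < s ->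
  (forall z, E z -> exists2 U, nbhs z U & exists (i : 'I_n) (K : R),
    forall u v, E u -> U u -> E v -> U v ->
      edist (F u) (F v) <= K * `|u ord0 i - v ord0 i|) ->
  hausdorff_null s (F @` E).
Proof.
move=> s1 loc.
pose box (ka : nat * {ffun 'I_n -> int}) : set 'rV[R]_n :=
  [set u | forall i, Num.floor (u ord0 i * ka.1.+1%:R) = ka.2 i].
pose good ka := hausdorff_null s (F @` (E `&` box ka)).
pose piece m : set (R * R) := [set p | exists ka,
  [/\ unpickle m = Some ka, good ka & (F @` (E `&` box ka)) p]].
apply: (@hausdorff_null_subset _ _ _ (\bigcup_m piece m)); last first.
  apply: hausdorff_null_bigcup => m.
  have [[ka [mka gka]]|no] := pselect (exists ka, unpickle m = Some ka /\ good ka).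
    apply: hausdorff_null_subset gka => p [ka' [mka' _ pE]].
    by move: mka'; rewrite mka => -[->].
  (* If [m] codes no good box, its piece is empty, and the empty set is null as an image of
     [set0]. *)
  apply: (@hausdorff_null_subset _ _ _ (F @` set0)); last first.
    apply: (@hausdorff_null_lipschitz _ _ (fun=> 0) F 0 1 1) => //.
  by move=> p [ka [mka gka _]]; exfalso; apply: no; exists ka.
move=> _ [z Ez <-]; have [U /nbhs_ballP[e /= e0 eU] [i [K FK]]] := loc z Ez.
pose k := Num.truncn e^-1.
have k0 : 0 < k.+1%:R :> R by rewrite ltr0n.
have ke : k.+1%:R^-1 < e.
  rewrite invf_plt ?posrE//.
  have ei0 : 0 <= e^-1 by rewrite invr_ge0 ltW.
  by have /andP[] := truncn_itv ei0.
pose a : {ffun 'I_n -> int} := [ffun i => Num.floor (z ord0 i * k.+1%:R)].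
have zbox : box (k, a) z by move=> j; rewrite ffunE.
exists (pickle (k, a)) => //; exists (k, a); rewrite pickleK; split=> //; last first.
  by exists z.
have boxP u j : box (k, a) u ->
    (a j)%:~R / k.+1%:R <= u ord0 j < (a j)%:~R / k.+1%:R + k.+1%:R^-1.
  move=> /(_ j) /= aj; have := floor_itv (u ord0 j * k.+1%:R).
  rewrite aj -[X in _ / _ + X]mul1r -mulrDl ler_pdivrMr// ltr_pdivlMr//.
  by rewrite intrD.
have boxU : box (k, a) `<=` U.
  move=> u ub; apply: eU; split => // r j; have -> : r = ord0 by exact: ord1.
  rewrite /ball /=.
  apply: le_lt_trans ke; move: (boxP _ j ub) (boxP _ j zbox).
  move: (_%:~R / _) => c; move: (_^-1) => q /andP[? ?] /andP[? ?].
  by rewrite ler_norml; apply/andP; split; lra.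
rewrite /good; apply: (@hausdorff_null_lipschitz _ (E `&` box (k, a))
  (fun u => u ord0 i) F
  ((a i)%:~R / k.+1%:R) k.+1%:R^-1 (`|K| + 1) s s1) => //.
- by move=> u [_ /(boxP _ i)].
- move=> u v [Eu /boxU Uu] [Ev /boxU Uv]; apply: (le_trans (FK _ _ Eu Uu Ev Uv)).
  by rewrite ler_wpM2r// (le_trans (ler_norm _))// lerDl.
Qed.

End LipschitzNull.

(** * Strict differentiability *)

Section StrictDerivative.
Context {R : realType}.

Definition strict_der (phi : R -> R) (a d : R) := exists Psi : R * R -> R,
  (\forall p \near (a, a), phi p.1 - phi p.2 = Psi p * (p.1 - p.2)) /\
  Psi p @[p --> (a, a)] --> d.

Lemma cvg_fst_comp (T U : topologicalType) (f : T -> U) (z : T) (l : U) :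
  f @ z --> l -> f p.1 @[p --> (z, z)] --> l.
Proof. by move=> fl; apply: cvg_comp fl; exact: cvg_fst. Qed.

Lemma cvg_snd_comp (T U : topologicalType) (f : T -> U) (z : T) (l : U) :
  f @ z --> l -> f p.2 @[p --> (z, z)] --> l.
Proof. by move=> fl; apply: cvg_comp fl; exact: cvg_snd. Qed.

Lemma cvg_pair_comp (T U : topologicalType) (f : T -> U) (z : T) (l : U) :
  f @ z --> l -> (f p.1, f p.2) @[p --> (z, z)] --> (l, l).
Proof.
move=> fl; apply: (@cvg_pair _ _ _ _ (nbhs l) (nbhs l)).
  exact: cvg_fst_comp.
exact: cvg_snd_comp.
Qed.

(** By the mean value theorem a difference quotient at two points near [a] is a value of [phi'] at a
    point between them, hence close to [phi' a]. *)
Lemma strict_der_C1 (phi phi' : R -> R) (a : R) :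
  (\forall t \near a, is_derive (t : R) (1 : R) phi (phi' t)) ->
  {for a, continuous phi'} ->
  strict_der phi a (phi' a).
Proof.
move=> dphi cphi.
(* On the diagonal the quotient is undefined, and [phi'] is its continuous extension there. *)
exists (fun p => if p.1 == p.2 then phi' p.1
                 else (phi p.1 - phi p.2) / (p.1 - p.2)); split.
  near=> p; case: eqP => [->|/eqP pne]; first by rewrite !subrr mulr0.
  by rewrite divfK// subr_eq0.
apply/cvgrPdist_lt => e e0.
have /nbhs_ballP[d /= d0 dP] : \forall t \near a,
    is_derive (t : R) (1 : R) phi (phi' t) /\ `|phi' a - phi' t| < e.
  by apply: filterI => //; move/cvgrPdist_lt : cphi; exact.
have slope x y : ball a d x -> ball a d y -> x < y ->
    `|phi' a - (phi x - phi y) / (x - y)| < e.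
  rewrite /ball /= => ax ay xy.
  have inb t : x <= t -> t <= y -> `|a - t| < d.
    move=> xt ty; move: ax ay; rewrite !ltr_norml => /andP[? ?] /andP[? ?].
    by apply/andP; split; lra.
  have inD t : t \in `[x, y] -> is_derive (t : R) (1 : R) phi (phi' t).
    by rewrite in_itv /= => /andP[xt ty]; have [] := dP _ (inb t xt ty).
  have dI t : t \in `]x, y[ -> is_derive (t : R) (1 : R) phi (phi' t).
    by move=> /subset_itv_oo_cc; exact: inD.
  have cI : {within `[x, y], continuous phi}.
    by apply: derivable_within_continuous => t /inD dt; exact: ex_derive.
  have [c] := MVT xy dI cI.
  rewrite in_itv /= => /andP[/ltW xc /ltW cy] E.
  have -> : (phi x - phi y) / (x - y) = phi' c.
    by rewrite -opprB E -[x - y]opprB invrN mulrNN mulfK// subr_eq0 gt_eqF.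
  by have [] := dP _ (inb c xc cy).
near=> p.
have p1 : ball a d p.1.
  by near: p; apply: (@cvg_fst _ _ (nbhs a) (nbhs a)); exact: nbhsx_ballx.
have p2 : ball a d p.2.
  by near: p; apply: (@cvg_snd _ _ (nbhs a) (nbhs a)); exact: nbhsx_ballx.
case: (ltgtP p.1 p.2) => [lt|gt|E]; first exact: slope.
- rewrite -[phi _ - _]opprB -[p.1 - p.2]opprB invrN mulrNN; exact: slope.
- by have [] := dP _ p1.
Unshelve. all: by end_near. Qed.

Lemma strict_der_inv (a : R) : a != 0 -> strict_der GRing.inv a (- a ^- 2).
Proof.
move=> a0; exists (fun p => - (p.1^-1 * p.2^-1)); split.
  near=> p.
  have p1 : p.1 != 0.
    near: p; apply: cvgr_neq0 a0; exact: cvg_fst.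
  have p2 : p.2 != 0.
    near: p; apply: cvgr_neq0 a0; exact: cvg_snd.
  by field; rewrite p1 p2.
have -> : - a ^- 2 = - (a^-1 * a^-1) by rewrite expr2 invfM.
by apply: cvgN; apply: cvgM; apply: cvgV => //; [exact: cvg_fst|exact: cvg_snd].
Unshelve. all: by end_near. Qed.

Lemma strict_der_sqrt (a : R) : 0 < a ->
  strict_der Num.sqrt a (2 * Num.sqrt a)^-1.
Proof.
move=> a0; apply: (@strict_der_C1 _ (fun t => (2 * Num.sqrt t)^-1)).
  near=> t; apply: is_derive1_sqrt; near: t; exact: lt_nbhsr.
apply: cvgV; first by rewrite mulf_neq0// gt_eqF// sqrtr_gt0.
by apply: cvgM; [exact: cvg_cst|exact: sqrt_continuous].
Unshelve. all: by end_near. Qed.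

Lemma strict_der_acos (a : R) : -1 < a < 1 ->
  strict_der (@acos R) a (- (Num.sqrt (1 - a ^+ 2))^-1).
Proof.
move=> /andP[a1 a2].
apply: (@strict_der_C1 _ (fun t => - (Num.sqrt (1 - t ^+ 2))^-1)).
  near=> t; apply: is_derive1_acos; apply/andP; split; near: t.
    exact: lt_nbhsr.
  exact: lt_nbhsl.
apply: cvgN; apply: cvgV; first by rewrite gt_eqF// sqrtr_gt0; nra.
apply: (@cvg_comp _ _ _ (fun t : R => 1 - t ^+ 2) Num.sqrt _
  (nbhs (1 - a ^+ 2))); last exact: sqrt_continuous.
by apply: cvgB; [exact: cvg_cst|exact: exprn_continuous].
Unshelve. all: by end_near. Qed.

End StrictDerivative.

Lemma cvg_sum (R : realType) (I : finType) (T : Type) (F : set_system T)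
    (FF : Filter F) (f : I -> T -> R) (l : I -> R) :
  (forall i, f i @ F --> l i) -> \sum_i f i x @[x --> F] --> \sum_i l i.
Proof.
move=> fl; elim: (index_enum I) => [|i s IHs].
  by under eq_fun do rewrite big_nil; rewrite big_nil; exact: cvg_cst.
under eq_fun do rewrite big_cons; rewrite big_cons.
by apply: cvgD.
Qed.

(** * Strict gradients in several variables *)

Section StrictGradient.
Context {R : realType} {n : nat}.
Implicit Types (f h : 'rV[R]_n -> R) (z : 'rV[R]_n) (g : 'I_n -> R).

(* Strict differentiability in Caratheodory form: the difference quotients in
   each variable extend continuously to the diagonal point [(z, z)]. *)
Definition strict_grad f z g := exists Phi : 'I_n -> 'rV[R]_n * 'rV[R]_n -> R,
  (\forall p \near (z, z),
     f p.1 - f p.2 = \sum_i Phi i p * (p.1 ord0 i - p.2 ord0 i)) /\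
  forall i, Phi i p @[p --> (z, z)] --> g i.

Lemma strict_grad_ext f z g g' : g =1 g' -> strict_grad f z g ->
  strict_grad f z g'.
Proof. by move=> /funext ->. Qed.

Lemma strict_grad_cvg f z g : strict_grad f z g -> f @ z --> f z.
Proof.
move=> [Phi [E cPhi]].
have c : (u, z) @[u --> z] --> (z, z).
  apply: (@cvg_pair _ _ _ (nbhs z) (nbhs z) (nbhs z) _ _ _ id (fun=> z)) => //.
  exact: cvg_cst.
have c0 : f u - f z @[u --> z] --> 0.
  have -> : 0 = \sum_i g i * (z ord0 i - z ord0 i).
    by rewrite big1// => i _; rewrite subrr mulr0.
  have : \sum_i Phi i (u, z) * (u ord0 i - z ord0 i) @[u --> z] -->
      \sum_i g i * (z ord0 i - z ord0 i).
    apply: (@cvg_sum _ _ _ _ (nbhs_filter z)) => i; apply: cvgM.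
      exact: cvg_comp c (cPhi i).
    by apply: cvgB; [exact: coord_continuous|exact: cvg_cst].
  apply: cvg_trans; apply: (@near_eq_cvg _ _ (nbhs z) (nbhs_filter z)).
  by apply: (@filterS _ _ (nbhs_filter z) _ _ _ (c _ E)) => u /= ->.
have fE : (fun u => f u - f z) + (fun=> f z) = f.
  by apply/funext => u; rewrite fctE /= subrK.
have h := cvgD c0 (cvg_cst (f z)); rewrite fE add0r in h.
exact: h (nbhs_filter z) (nbhs_filter z).
Qed.

Lemma strict_grad_cst (c : R) z : strict_grad (fun=> c) z (fun=> 0).
Proof.
exists (fun _ _ => 0); split; last by move=> i; exact: cvg_cst.
by near=> p; rewrite subrr big1// => i _; rewrite mul0r.
Unshelve. all: by end_near. Qed.

Lemma strict_gradD f h z a b : strict_grad f z a -> strict_grad h z b ->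
  strict_grad (fun u => f u + h u) z (fun i => a i + b i).
Proof.
move=> [A [EA cA]] [B [EB cB]]; exists (fun i p => A i p + B i p); split.
  near=> p; rewrite opprD addrACA (near EA p)// (near EB p)// -big_split /=.
  by apply: eq_bigr => i _; rewrite mulrDl.
by move=> i; apply: cvgD.
Unshelve. all: by end_near. Qed.

Lemma strict_gradM f h z a b : strict_grad f z a -> strict_grad h z b ->
  strict_grad (fun u => f u * h u) z (fun i => a i * h z + f z * b i).
Proof.
move=> fa hb; have fz := strict_grad_cvg fa; have hz := strict_grad_cvg hb.
move: fa hb => [A [EA cA]] [B [EB cB]].
exists (fun i p => A i p * h p.1 + f p.2 * B i p); split.
  near=> p.
  have -> : f p.1 * h p.1 - f p.2 * h p.2 =
      h p.1 * (f p.1 - f p.2) + f p.2 * (h p.1 - h p.2) by ring.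
  rewrite (near EA p)// (near EB p)// !mulr_sumr -big_split /=.
  by apply: eq_bigr => i _; ring.
move=> i; apply: cvgD; apply: cvgM => //.
  exact: cvg_fst_comp.
exact: cvg_snd_comp.
Unshelve. all: by end_near. Qed.

Lemma strict_grad_comp phi f z d a : strict_der phi (f z) d ->
  strict_grad f z a -> strict_grad (fun u => phi (f u)) z (fun i => d * a i).
Proof.
move=> [Psi [EPsi cPsi]] fa; have fz := strict_grad_cvg fa.
have c : (f p.1, f p.2) @[p --> (z, z)] --> (f z, f z).
  exact: cvg_pair_comp.
move: fa => [A [EA cA]].
exists (fun i p => Psi (f p.1, f p.2) * A i p); split.
  have := c _ EPsi; rewrite nbhs_nearE near_map /= => EP.
  near=> p; rewrite (near EP p)//= (near EA p)// mulr_sumr.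
  by apply: eq_bigr => i _; rewrite mulrA.
by move=> i; apply: cvgM => //; apply: cvg_comp c cPsi.
Unshelve. all: by end_near. Qed.

Lemma strict_gradN f z a : strict_grad f z a ->
  strict_grad (fun u => - f u) z (fun i => - a i).
Proof.
move=> [A [EA cA]]; exists (fun i p => - A i p); split.
  near=> p; rewrite -opprD (near EA p)// -sumrN.
  by apply: eq_bigr => i _; rewrite mulNr.
by move=> i; apply: cvgN.
Unshelve. all: by end_near. Qed.

Lemma strict_grad_coord (k : 'I_n) z :
  strict_grad (fun u => u ord0 k) z (fun i => (i == k)%:R).
Proof.
exists (fun i _ => (i == k)%:R); split; last by move=> i; exact: cvg_cst.
near=> p; rewrite (bigD1 k)//= eqxx mul1r big1 ?addr0// => i /negPf ->.
by rewrite mul0r.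
Unshelve. all: by end_near. Qed.

Lemma strict_grad_comp_coord phi (k : 'I_n) z d :
  strict_der phi (z ord0 k) d ->
  strict_grad (fun u => phi (u ord0 k)) z (fun i => (i == k)%:R * d).
Proof.
move=> dphi; apply: strict_grad_ext (strict_grad_comp dphi (strict_grad_coord k z)).
by move=> i; rewrite mulrC.
Qed.

(* Cramer's rule: where [f] and [h] are constant, the increments in the
   coordinates [j] and [k] are multiples of the increment in coordinate [i]. *)
Lemma strict_grad_graph (i j k : 'I_n) f h z a b (F1 F2 : 'rV[R]_n -> R) c1 c2 :
  (forall G : 'I_n -> R, \sum_m G m = G i + G j + G k) ->
  strict_grad f z a -> strict_grad h z b -> a j * b k - a k * b j != 0 ->
  strict_grad F1 z c1 -> strict_grad F2 z c2 ->
  exists2 U, nbhs z U & exists K : R, forall u v, U u -> U v ->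
    f u = f v -> h u = h v ->
    edist (F1 u, F2 u) (F1 v, F2 v) <= K * `|u ord0 i - v ord0 i|.
Proof.
move=> sumE [A [EA cA]] [B [EB cB]] D0 fc1 fc2.
pose D p := A j p * B k p - A k p * B j p.
have cD : D p @[p --> (z, z)] --> a j * b k - a k * b j.
  by apply: cvgB; apply: cvgM.
pose rj p := (A k p * B i p - A i p * B k p) / D p.
pose rk p := (A i p * B j p - A j p * B i p) / D p.
have crj : rj p @[p --> (z, z)] --> (a k * b i - a i * b k) / (a j * b k - a k * b j).
  by apply: cvgM; [apply: cvgB; apply: cvgM|apply: cvgV].
have crk : rk p @[p --> (z, z)] --> (a i * b j - a j * b i) / (a j * b k - a k * b j).
  by apply: cvgM; [apply: cvgB; apply: cvgM|apply: cvgV].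
(* The increments in [j] and [k] are [rj] and [rk] times the one in [i], so that of [F] is [Q p]
   times it; [Q] converges at [(z, z)] and is therefore bounded nearby. *)
have graph F c : strict_grad F z c -> exists2 K, 0 <= K & \forall p \near (z, z),
    f p.1 = f p.2 -> h p.1 = h p.2 ->
    `|F p.1 - F p.2| <= K * `|p.1 ord0 i - p.2 ord0 i|.
  move=> [C [EC cC]].
  pose Q p := C i p + C j p * rj p + C k p * rk p.
  pose q := c i + c j * ((a k * b i - a i * b k) / (a j * b k - a k * b j))
    + c k * ((a i * b j - a j * b i) / (a j * b k - a k * b j)).
  have cQ : Q p @[p --> (z, z)] --> q.
    by apply: cvgD; [apply: cvgD => //|]; apply: cvgM.
  exists (`|q| + 1); first by rewrite addr_ge0.
  near=> p => fp hp.
  have Dp : D p != 0 by near: p; apply: cvgr_neq0 D0.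
  have Qp : `|Q p| <= `|q| + 1 by near: p; apply: cvgr_norm_le cQ _ _; rewrite ltrDl.
  rewrite (near EC p)// sumE.
  have : f p.1 - f p.2 = 0 by rewrite fp subrr.
  rewrite (near EA p)// sumE.
  have : h p.1 - h p.2 = 0 by rewrite hp subrr.
  rewrite (near EB p)// sumE.
  set x := p.1 ord0 i - _; set y := p.1 ord0 j - _; set w := p.1 ord0 k - _.
  move=> Eb Ea.
  have yE : y = rj p * x.
    apply: (mulfI Dp); rewrite /rj mulrA mulrCA divff// mulr1 /D.
    apply/eqP; rewrite -subr_eq0; apply/eqP.
    transitivity (B k p * (A i p * x + A j p * y + A k p * w) -
      A k p * (B i p * x + B j p * y + B k p * w)); first by ring.
    by rewrite Ea Eb; ring.
  have wE : w = rk p * x.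
    apply: (mulfI Dp); rewrite /rk mulrA mulrCA divff// mulr1 /D.
    apply/eqP; rewrite -subr_eq0; apply/eqP.
    transitivity (A j p * (B i p * x + B j p * y + B k p * w) -
      B j p * (A i p * x + A j p * y + A k p * w)); first by ring.
    by rewrite Ea Eb; ring.
  rewrite yE wE; have -> : C i p * x + C j p * (rj p * x) + C k p * (rk p * x) =
    Q p * x by rewrite /Q; ring.
  by rewrite normrM ler_wpM2r.
have [K1 K10 N1] := graph _ _ fc1; have [K2 K20 N2] := graph _ _ fc2.
have [[U V] /= [zU zV] UV] : nbhs (z, z) (fun p =>
    (f p.1 = f p.2 -> h p.1 = h p.2 ->
      `|F1 p.1 - F1 p.2| <= K1 * `|p.1 ord0 i - p.2 ord0 i|) /\
    (f p.1 = f p.2 -> h p.1 = h p.2 ->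
      `|F2 p.1 - F2 p.2| <= K2 * `|p.1 ord0 i - p.2 ord0 i|)) by exact: filterI.
exists (U `&` V); first exact: filterI.
exists (K1 + K2) => u v [Uu Vu] [Uv Vv] fuv huv.
have [h1 h2] := UV (u, v) (conj Uu Vv).
apply: (le_trans (edist_le_sum _ _)); rewrite mulrDl.
by apply: lerD; [exact: h1|exact: h2].
Unshelve. all: by end_near. Qed.

End StrictGradient.

(** * One-sidedness of the table *)

Section Paths.
Context {R : realType}.

(** On a path that misses the boundary, [D] and its closure contain the same points, so the times
    spent in [D] form an open and closed subset of [[0, 1]]. *)
Lemma path_avoiding_boundary (T : topologicalType) (D : set T) (f : R -> T) :
  open D -> continuous f ->
  (forall t, 0 <= t <= 1 -> ~ (closure D `\` D) (f t)) ->
  D (f 0) -> D (f 1).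
Proof.
move=> oD cf avoid D0.
pose B := `[0, 1] `&` f @^-1` D : set R.
suff BE : B = `[0, 1]%classic.
  have : B 1 by rewrite BE /= in_itv /= ler01 lexx.
  by case.
apply: (@segment_connected R 0 1 B).
- by exists 0; split=> //=; rewrite in_itv /= lexx ler01.
- by exists (f @^-1` D) => //; exact: open_comp.
- exists (f @^-1` closure D).
    by apply: closed_comp => //; exact: closed_closure.
  apply/seteqP; split=> t [t01 Dt]; split=> //; first exact: subset_closure.
  by apply: contrapT => nD; apply: (avoid t).
Qed.

Lemma segment_gt (m a b x : R) : 0 <= x <= 1 -> m < a -> m < b ->
  m < a + x * (b - a).
Proof.
by move=> /andP[x0 x1] ma mb; have [ab|/ltW ba] := leP a b; nra.
Qed.

Lemma segment_lt (m a b x : R) : 0 <= x <= 1 -> a < m -> b < m ->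
  a + x * (b - a) < m.
Proof.
move=> x01 am bm; rewrite -ltrN2.
have -> : - (a + x * (b - a)) = - a + x * (- b - - a) by ring.
by apply: segment_gt; rewrite ?ltrN2.
Qed.

Lemma locally_constant (P : R -> Prop) :
  (forall a, \forall t \near a, P t <-> P a) -> forall a b, P a -> P b.
Proof.
move=> loc a b Pa.
suff : [set t | P t] = [set: R] by move=> /seteqP[_ /(_ b)]; exact.
have oP (Q : R -> Prop) : (forall a, \forall t \near a, Q t <-> Q a) ->
    open [set t | Q t].
  move=> locQ; rewrite openE => t /= Qt; rewrite /interior.
  by apply: filterS (locQ t) => u [_]; exact.
have cR : connected [set: R] by apply/connected_intervalP => x y.
apply: cR; first by exists a.
  by exists [set t | P t]; rewrite ?setTI//; exact: oP.
exists [set t | P t]; rewrite ?setTI// -openC; apply: oP => t.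
by apply: filterS (loc t) => u Pu; split=> nP; contradict nP; apply/Pu.
Qed.

End Paths.

(** * The two sides of the boundary curve *)

Section Table.
Context {R : realType} {l : R} {gamma : R -> R * R} {D : set (R * R)}.
Context (hD : billiard l gamma D) (hC : class_C_curve 3 gamma).

Local Notation X := (fst \o gamma).
Local Notation Y := (snd \o gamma).

Lemma class_C_strict (f : R -> R) k n t : class_C k f -> (n < k)%N ->
  strict_der (derive1n n f) t (derive1n n.+1 f t).
Proof.
move=> [df cf] nk; apply: (@strict_der_C1 _ (derive1n n f) (derive1n n.+1 f)).
  near=> u; rewrite derive1nS derive1E; apply: derivableP; exact: df.
have : (n.+1 <= k)%N by [].
rewrite leq_eqVlt => /predU1P[->|nk']; first exact: cf.
apply: differentiable_continuous; apply/derivable1_diffP; exact: df.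
Unshelve. all: by end_near. Qed.

Lemma gamma_periodic_int (k : int) t : gamma (t + k%:~R * l) = gamma t.
Proof.
have nat k' t' : gamma (t' + k'%:R * l) = gamma t'.
  elim: k' t' => [|k' IH] t'; first by rewrite mul0r addr0.
  by rewrite -addn1 natrD mulrDl mul1r addrA (billiard_periodic hD) IH.
case: k => k; first exact: nat.
rewrite NegzE -(nat k.+1); congr gamma.
by rewrite mulrNz mulNr -addrA addNr addr0.
Qed.

(** Brings any parameter into the window of one period centred at [a], so that compactness of a
    segment can be used. *)
Lemma gamma_reduce (a t : R) :
  exists2 t', gamma t' = gamma t & a - l / 2 <= t' <= a + l / 2.
Proof.
have l0 := billiard_length_gt0 hD.
pose k := Num.floor ((t - a) / l + 2^-1).
exists (t - k%:~R * l).
  by rewrite -[RHS](gamma_periodic_int (- k)) mulrNz mulNr.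
have := floor_itv ((t - a) / l + 2^-1); rewrite -/k intrD.
have : t = a + (t - a) / l * l by rewrite divfK ?gt_eqF// addrC subrK.
move: ((t - a) / l) k%:~R => q x tE /andP[h1 h2].
have := mulr_ge0 (ltW l0) (_ : 0 <= q + 2^-1 - x).
have := mulr_ge0 (ltW l0) (_ : 0 <= x + 1 - (q + 2^-1)).
rewrite !subr_ge0 => /(_ (ltW h2)) h3 /(_ h1) h4.
by apply/andP; rewrite tE; split; lra.
Qed.

Lemma gamma_inj_near t0 t : t0 - l / 2 <= t <= t0 + l / 2 ->
  gamma t = gamma t0 -> t = t0.
Proof.
have l0 := billiard_length_gt0 hD.
move=> /andP[h1 h2] /(billiard_simple hD)[k E].
suff -> : t = t0 by [].
have : `|k%:~R : R| * l < l.
  rewrite -[X in _ * X]gtr0_norm// -normrM.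
  have -> : k%:~R * l = t0 - t by rewrite E addrAC subrr add0r.
  by apply: (@le_lt_trans _ _ (l / 2)); [rewrite ler_norml; apply/andP; split|]; lra.
rewrite -[X in _ < X]mul1r ltr_pM2r// -intr_norm -[1]/(1%:~R) ltr_int.
rewrite -[1]add0r ltzD1 normr_le0 => /eqP k0.
by move: E; rewrite k0 mul0r addr0.
Qed.

Let X1 := derive1 X.
Let Y1 := derive1 Y.

Lemma gamma_strict t : strict_der X t (X1 t) /\ strict_der Y t (Y1 t).
Proof.
split; first exact: (@class_C_strict X 3 0 t hC.1).
exact: (@class_C_strict Y 3 0 t hC.2).
Qed.

Lemma unit_speed t : X1 t * X1 t + Y1 t * Y1 t = 1.
Proof. exact: (billiard_arclength hD t). Qed.

(** The vector with component [c] along the tangent and [s] along the normal, the tangent turned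
    counterclockwise by a right angle. *)
Definition frame (c s t : R) : R * R :=
  (c * derive1 X t - s * derive1 Y t, c * derive1 Y t + s * derive1 X t).

Lemma coord_cont t : {for t, continuous X} /\ {for t, continuous Y} /\
  {for t, continuous X1} /\ {for t, continuous Y1}.
Proof.
have [[dX _] [dY _]] := hC.
have d (f : R -> R) : derivable f t 1 -> {for t, continuous f}.
  by move=> df; apply: differentiable_continuous; apply/derivable1_diffP.
by split; [|split; [|split]]; apply: d;
  [exact: (dX 0%N)|exact: (dY 0%N)|exact: (dX 1%N)|exact: (dY 1%N)].
Qed.

Lemma frame_cont c s t :
  {for t, continuous (fun t => (frame c s t).1)} /\
  {for t, continuous (fun t => (frame c s t).2)}.
Proof.
have [_ [_ [cX1 cY1]]] := coord_cont t; split.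
  exact: (cvgB (cvgM (cvg_cst c) cX1) (cvgM (cvg_cst s) cY1)).
exact: (cvgD (cvgM (cvg_cst c) cY1) (cvgM (cvg_cst s) cX1)).
Qed.

Lemma pair_cvg (T : topologicalType) (F : set_system T) (FF : Filter F)
    (f g : T -> R) (a b : R) :
  f @ F --> a -> g @ F --> b -> (f x, g x) @[x --> F] --> (a, b).
Proof. by move=> fa gb; apply: (@cvg_pair _ _ _ _ (nbhs a) (nbhs b)). Qed.

(** Collar coordinates: [p.1] is the foot on the curve and [p.2] the distance travelled along
    [frame c s], a direction transversal to the curve when [s != 0]. *)
Definition tube (c s : R) (p : R * R) : R * R :=
  (X p.1 + p.2 * (frame c s p.1).1, Y p.1 + p.2 * (frame c s p.1).2).

Lemma tubeE c s a r : tube c s (a, r) = gamma a + r *: frame c s a.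
Proof. by rewrite /tube /=; case: (gamma a). Qed.

Lemma tube_continuous c s : continuous (tube c s).
Proof.
move=> [a r]; have [cX [cY _]] := coord_cont a.
have [cf1 cf2] := frame_cont c s a.
have c1 (f : R -> R) : {for a, continuous f} -> f p.1 @[p --> (a, r)] --> f a.
  by move=> cf; apply: (@cvg_comp _ _ _ fst f _ (nbhs a)) => //; exact: cvg_fst.
have c2 : p.2 @[p --> (a, r)] --> r by exact: cvg_snd.
apply: pair_cvg.
  exact: (cvgD (c1 _ cX) (cvgM c2 (c1 _ cf1))).
exact: (cvgD (c1 _ cY) (cvgM c2 (c1 _ cf2))).
Qed.

(** If [gamma t] lay on the ray from [gamma a], the chord between them would be parallel to
    [frame c s a]. Near [t0] chord directions are close to the tangent, whose cross product [w] with
    the frame vector is close to [s], so [t = a] and then the frame vector would vanish. *)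
Lemma tube_free_near c s t0 : s != 0 ->
  exists2 d, 0 < d & forall a r t, `|a - t0| < d -> `|t - t0| < d -> 0 < r ->
    gamma t <> tube c s (a, r).
Proof.
move=> s0; have [[Qx [EX cQx]] [Qy [EY cQy]]] := gamma_strict t0.
pose w p := Qx p * (frame c s p.2).2 - Qy p * (frame c s p.2).1.
have cw : w p @[p --> (t0, t0)] -->
    X1 t0 * (c * Y1 t0 + s * X1 t0) - Y1 t0 * (c * X1 t0 - s * Y1 t0).
  have [cf1 cf2] := frame_cont c s t0.
  exact: (cvgB (cvgM cQx (cvg_snd_comp cf2)) (cvgM cQy (cvg_snd_comp cf1))).
have [[U V] /= [/nbhs_ballP[d1 /= d10 U1] /nbhs_ballP[d2 /= d20 V2]] UV] :
    nbhs (t0, t0) (fun p => [/\ X p.1 - X p.2 = Qx p * (p.1 - p.2),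
      Y p.1 - Y p.2 = Qy p * (p.1 - p.2) & w p != 0]).
  have w0 : \forall p \near (t0, t0), w p != 0.
    apply: cvgr_neq0 cw _; have -> : X1 t0 * (c * Y1 t0 + s * X1 t0) -
      Y1 t0 * (c * X1 t0 - s * Y1 t0) = s * (X1 t0 * X1 t0 + Y1 t0 * Y1 t0) by ring.
    by rewrite unit_speed mulr1.
  by near=> p; split; near: p.
exists (Num.min d1 d2); first by rewrite lt_min d10.
move=> a r t; rewrite !lt_min => /andP[_ ad] /andP[td _] r0.
rewrite /tube /= => /(congr1 (fun q => (q.1, q.2))) [ex ey].
have [] := UV (t, a).
  by split; [apply: U1|apply: V2]; rewrite /ball /= distrC.
rewrite /= ex ey => hx hy w0.
have {}hx : r * (frame c s a).1 = Qx (t, a) * (t - a) by rewrite -hx /=; ring.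
have {}hy : r * (frame c s a).2 = Qy (t, a) * (t - a) by rewrite -hy /=; ring.
have ta : t = a.
  apply/eqP; rewrite -subr_eq0; apply/eqP/(mulIf w0); rewrite mul0r.
  transitivity ((Qx (t, a) * (t - a)) * (frame c s a).2 -
    (Qy (t, a) * (t - a)) * (frame c s a).1); first by rewrite /w; ring.
  by rewrite -hx -hy; ring.
move: hx hy; rewrite ta subrr !mulr0 => /eqP + /eqP.
rewrite !mulf_eq0 (gt_eqF r0)/= => /eqP f1 /eqP f2.
by move: w0; rewrite ta /w /= f1 f2 !mulr0 subrr eqxx.
Unshelve. all: by end_near. Qed.

(** Parameters near [t0] are excluded by [tube_free_near]. The others, reduced to one period, form a
    compact set whose image misses [gamma t0] and hence a neighbourhood of it. *)
Lemma tube_free c s t0 : s != 0 ->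
  exists2 e, 0 < e & forall a r, `|a - t0| < e -> 0 < r -> r < e ->
    ~ range gamma (tube c s (a, r)).
Proof.
move=> s0; have [d d0 hd] := tube_free_near c t0 s0.
pose I := `[t0 - l / 2, t0 + l / 2] `\` ball t0 d : set R.
have gc : continuous gamma.
  move=> t; have [cX [cY _]] := coord_cont t.
  have -> : gamma = (fun t => (X t, Y t)) by apply/funext => u /=; case: (gamma u).
  exact: pair_cvg.
have cI : compact (gamma @` I).
  apply: continuous_compact; first exact: continuous_subspaceT.
  apply: (@subclosed_compact _ _ `[t0 - l / 2, t0 + l / 2]).
  - rewrite /I setDE; apply: closedI; first exact: itv_closed.
    exact/open_closedC/ball_open.
  - exact: segment_compact.
  - by move=> t [].
have ncI : ~ (gamma @` I) (tube c s (t0, 0)).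
  have -> : tube c s (t0, 0) = gamma t0.
    by rewrite tubeE scale0r addr0.
  move=> [t [tI tb] /gamma_inj_near E]; apply: tb; rewrite E//; exact: ballxx.
have oK : open (~` (gamma @` I)).
  by rewrite openC; apply: compact_closed cI; exact: norm_hausdorff.
have [[U V] /= [/nbhs_ballP[d1 /= d10 U1] /nbhs_ballP[d2 /= d20 V2]] UV] :=
  @tube_continuous c s (t0, 0) _ (open_nbhs_nbhs (conj oK ncI)).
exists (Num.min d (Num.min d1 d2)); first by rewrite !lt_min d0 d10.
move=> a r; rewrite !lt_min => /and3P[ad ad1 _] r0 /and3P[rd _ rd2] [t _ Et].
have [t' Et' t'I] := gamma_reduce t0 t.
have [t'd|t'd] := ltP `|t' - t0| d.
  by apply: (hd a r t' ad t'd r0); rewrite Et' Et.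
have [] := UV (a, r).
  split; [apply: U1|apply: V2]; rewrite /ball /=; first by rewrite distrC.
  by rewrite sub0r normrN gtr0_norm.
exists t'; last by rewrite Et'.
split; first by rewrite /= in_itv.
by rewrite /ball /= distrC; apply/negP; rewrite -leNgt.
Qed.

Definition inside (c s t : R) := exists2 e, 0 < e &
  forall r, 0 < r -> r < e -> D (tube c s (t, r)).

(** In tube coordinates a straight segment joins a low point over [b] to any low point over [b']; it
    misses the boundary, so both ends lie in [D] together. *)
Lemma inside_locally c s a : s != 0 ->
  \forall t \near a, inside c s t <-> inside c s a.
Proof.
move=> s0; have [e e0 free] := tube_free c a s0.
have slide b b' : `|b - a| < e -> `|b' - a| < e -> inside c s b -> inside c s b'.
  move=> ba b'a [e1 e10 De1]; exists e => // r r0 re.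
  (* Low enough for the start of the segment to be in [D] and in the region free of the curve. *)
  pose r1 := Num.min e e1 / 2.
  have m0 : 0 < Num.min e e1 by rewrite lt_min e0.
  have r10 : 0 < r1 by rewrite /r1; lra.
  have r1m : r1 < Num.min e e1 by rewrite /r1; lra.
  move: r1m; rewrite lt_min => /andP[r1e r1e1].
  pose f x := tube c s (b + x * (b' - b), r1 + x * (r - r1)).
  have f0 : f 0 = tube c s (b, r1) by rewrite /f !mul0r !addr0.
  have f1 : f 1 = tube c s (b', r).
    by rewrite /f !mul1r !addrA ![_ + _ - _]addrAC !subrr !add0r.
  rewrite -f1; apply: (path_avoiding_boundary (billiard_open hD)); last first.
  - by rewrite f0; exact: De1.
  - move=> x x01; rewrite (billiard_boundary hD); apply: free.
    + move: ba b'a; rewrite !ltr_distl => /andP[? ?] /andP[? ?].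
      by rewrite segment_gt ?segment_lt.
    + exact: segment_gt.
    + exact: segment_lt.
  - move=> x; apply: (@cvg_comp _ _ _ (fun x => (b + x * (b' - b), r1 + x * (r - r1)))
      (tube c s) _ (nbhs (b + x * (b' - b), r1 + x * (r - r1)))).
      apply: pair_cvg.
        exact: (cvgD (cvg_cst _) (cvgM cvg_id (cvg_cst _))).
      exact: (cvgD (cvg_cst _) (cvgM cvg_id (cvg_cst _))).
    exact: (@tube_continuous c s).
near=> t; have ta : `|t - a| < e.
  by rewrite distrC; near: t; exact: nbhsx_ballx.
by split; apply: slide => //; rewrite subrr normr0.
Unshelve. all: by end_near. Qed.

Lemma exists_rightmost : exists t0, forall t, X t <= X t0.
Proof.
have l0 := billiard_length_gt0 hD.
have cX : {within `[- (l / 2), l / 2], continuous X}.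
  by apply: continuous_subspaceT => t; have [] := coord_cont t.
have [|t0 _ h] := EVT_max _ cX; first by lra.
exists t0 => t; have [t' /= <-] := gamma_reduce 0 t.
by rewrite sub0r add0r => ?; apply: h; rewrite in_itv.
Qed.

(** A table point further right than the whole curve could be pushed to the right indefinitely
    without meeting the boundary, against boundedness. *)
Lemma table_le_rightmost t0 p : (forall t, X t <= X t0) -> D p -> p.1 <= X t0.
Proof.
move=> max Dp; rewrite leNgt; apply/negP => px.
have [M DM] : exists M, forall q, D q -> `|q| <= M.
  have [M [_ /(_ (M + 1))]] := billiard_bounded hD.
  by rewrite ltrDl => /(_ ltr01) DM; exists (M + 1).
pose f x : R * R := (p.1 + x * (`|M| + `|p.1| + 1), p.2).
have k0 : 0 <= `|M| + `|p.1| + 1 by rewrite !addr_ge0.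
have : D (f 1).
  apply: (path_avoiding_boundary (billiard_open hD)).
  - move=> x; apply: pair_cvg; last exact: cvg_cst.
    exact: (cvgD (cvg_cst _) (cvgM cvg_id (cvg_cst _))).
  - move=> x /andP[x0 x1]; rewrite (billiard_boundary hD) => -[t _ /(congr1 fst)].
    rewrite /f /= => E; have := max t; rewrite /= E leNgt => /negP; apply.
    by rewrite (lt_le_trans px)// lerDl mulr_ge0.
  - by rewrite /f mul0r addr0 -surjective_pairing.
move=> /DM; rewrite /f mul1r => h.
have : `|p.1 + (`|M| + `|p.1| + 1)| <= M.
  by apply: le_trans h; rewrite prod_normE /= le_max lexx.
rewrite leNgt => /negP; apply.
apply: lt_le_trans (ler_norm _).
by have := ler_norm M; have := ler_norm (- p.1); rewrite normrN; lra.
Qed.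

Lemma rightmost_vertical t0 : (forall t, X t <= X t0) -> X1 t0 = 0.
Proof.
move=> max; have [[dX _] _] := hC.
have h : is_derive t0 (1 : R) X 0.
  apply: (@derive1_at_max _ _ (t0 - 1) (t0 + 1)).
  - lra.
  - by move=> t _; exact: (dX 0%N).
  - by rewrite in_itv /=; apply/andP; split; lra.
  - by move=> t _.
by rewrite /X1 derive1E derive_val.
Qed.

(** Being inside on either side propagates along the whole curve, in particular to a rightmost
    point. There the tangent is vertical and the table lies to the left, so only one sign of the
    normal component is possible. *)
Lemma one_sided c s t : s != 0 -> inside c s t -> ~ inside c (- s) t.
Proof.
move=> s0 i1 i2; have [t0 max] := exists_rightmost.
have sN0 : - s != 0 by rewrite oppr_eq0.
have loc s' : s' != 0 -> inside c s' t -> inside c s' t0.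
  by move=> s'0; apply: locally_constant => a; exact: inside_locally.
have := loc _ s0 i1; have := loc _ sN0 i2.
have X10 := rightmost_vertical max.
have key s' : s' != 0 -> inside c s' t0 -> 0 <= s' * Y1 t0.
  move=> s'0 [e e0 De]; have e2 : 0 < e / 2 by lra.
  have := table_le_rightmost max (De (e / 2) e2 _).
  rewrite /tube /= -/(X1 t0) -/(Y1 t0) X10 => /(_ ltac:(lra)).
  by rewrite gerDl pmulr_rle0// mulr0 sub0r oppr_le0.
move=> /(key _ sN0) h2 /(key _ s0) h1.
have : s * Y1 t0 = 0 by lra.
move/eqP; rewrite mulf_eq0 (negPf s0)/= => /eqP Y10.
by have := unit_speed t0; rewrite X10 Y10 !mul0r addr0 => /eqP; rewrite eq_sym oner_eq0.
Qed.

Lemma frame_decomposition c t v : dotp v v = 1 -> dotp v (tangent gamma t) = c ->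
  exists2 n, v = frame c n t & n ^+ 2 = 1 - c ^+ 2.
Proof.
case: v => v1 v2; rewrite /dotp /= -/(X1 t) -/(Y1 t) => vv vT.
have u := unit_speed t.
exists (v2 * X1 t - v1 * Y1 t); rewrite /frame -/(X1 t) -/(Y1 t) -vT.
  congr pair.
    transitivity (v1 * (X1 t * X1 t + Y1 t * Y1 t)); first by rewrite u mulr1.
    by ring.
  transitivity (v2 * (X1 t * X1 t + Y1 t * Y1 t)); first by rewrite u mulr1.
  by ring.
transitivity ((v1 * v1 + v2 * v2) * (X1 t * X1 t + Y1 t * Y1 t) -
  (v1 * X1 t + v2 * Y1 t) ^+ 2); first by ring.
by rewrite vv u mulr1.
Qed.

(** The angle fixes the tangential component, leaving two vectors that are mirror images in the
    tangent; [one_sided] discards one. This identifies the vector leaving a bounce point with the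
    reflection of the one arriving. *)
Lemma outgoing_unique p v v' :
  outgoing gamma D p v -> outgoing gamma D p v' -> v = v'.
Proof.
move=> [_ vv vT [e e0 De]] [_ vv' vT' [e' e'0 De']].
have [n vE n2] := frame_decomposition vv vT.
have [n' vE' n2'] := frame_decomposition vv' vT'.
have : n ^+ 2 == n' ^+ 2 by rewrite n2 n2'.
rewrite vE vE' eqf_sqr => /orP[/eqP ->//|/eqP nn'].
have [n0|n0] := eqVneq n' 0; first by rewrite nn' n0 oppr0.
have i1 : inside (cos p.2) n' p.1.
  by exists e' => // r r0 re; rewrite tubeE -vE'; exact: De'.
suff : inside (cos p.2) (- n') p.1 by move/(one_sided n0 i1).
by exists e => // r r0 re; rewrite tubeE -nn' -vE; exact: De.
Qed.

End Table.

(** * Acceleration of a unit-speed curve *)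

Section Acceleration.
Context {R : realType} {l : R} {gamma : R -> R * R} {D : set (R * R)}.
Context (hD : billiard l gamma D) (hC : class_C_curve 3 gamma).

Local Notation X1 := (derive1n 1 (fst \o gamma)).
Local Notation Y1 := (derive1n 1 (snd \o gamma)).
Local Notation X2 := (derive1n 2 (fst \o gamma)).
Local Notation Y2 := (derive1n 2 (snd \o gamma)).

Lemma acceleration_orthogonal t : X1 t * X2 t + Y1 t * Y2 t = 0.
Proof.
have [[dX _] [dY _]] := hC.
have iX : is_derive t (1 : R) X1 (X2 t).
  by rewrite -[X2 t]/(derive1 X1 t) derive1E; apply: derivableP; exact: (dX 1%N).
have iY : is_derive t (1 : R) Y1 (Y2 t).
  by rewrite -[Y2 t]/(derive1 Y1 t) derive1E; apply: derivableP; exact: (dY 1%N).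
have i1 := is_deriveD (is_deriveM iX iX) (is_deriveM iY iY).
have E : X1 * X1 + Y1 * Y1 = cst 1 by apply/funext => u; exact: (unit_speed hD).
rewrite E in i1; have := derive_val (is_derive := i1); rewrite derive_cst.
move: (X1 t) (X2 t) (Y1 t) (Y2 t) => a b c d.
rewrite -![_ *: _]/(_ * _).
lra.
Qed.

End Acceleration.

(** * Bounce triangles *)

Local Notation i0 := (@Ordinal 3 0 isT).
Local Notation i1 := (@Ordinal 3 1 isT).
Local Notation i2 := (@Ordinal 3 2 isT).

Section Chords.
Context {R : realType} {X Y X1 Y1 X2 Y2 X3 Y3 : R -> R}.
Context (sX : forall t, strict_der X t (X1 t)).
Context (sY : forall t, strict_der Y t (Y1 t)).
Context (sX1 : forall t, strict_der X1 t (X2 t)).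
Context (sY1 : forall t, strict_der Y1 t (Y2 t)).
Context (sX2 : forall t, strict_der X2 t (X3 t)).
Context (sY2 : forall t, strict_der Y2 t (Y3 t)).
Context (speed1 : forall t, X1 t * X1 t + Y1 t * Y1 t = 1).
Context (orthogonal : forall t, X1 t * X2 t + Y1 t * Y2 t = 0).

Definition curvature t := X1 t * Y2 t - Y1 t * X2 t.

Lemma acceleration t : X2 t = - curvature t * Y1 t /\ Y2 t = curvature t * X1 t.
Proof.
have u := speed1 t; have o := orthogonal t; split.
  transitivity (X2 t * (X1 t * X1 t + Y1 t * Y1 t) -
      X1 t * (X1 t * X2 t + Y1 t * Y2 t)); first by rewrite u o; ring.
  by rewrite /curvature; ring.
transitivity (Y2 t * (X1 t * X1 t + Y1 t * Y1 t) -
    Y1 t * (X1 t * X2 t + Y1 t * Y2 t)); first by rewrite u o; ring.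
by rewrite /curvature; ring.
Qed.

(** * First variation of chord lengths and angles *)

Section Gradients.
Context {n : nat}.
Implicit Types (i j k : 'I_n) (u z : 'rV[R]_n).

Definition dX i j u := X (u ord0 j) - X (u ord0 i).
Definition dY i j u := Y (u ord0 j) - Y (u ord0 i).
Definition len i j u := Num.sqrt (dX i j u * dX i j u + dY i j u * dY i j u).

(* Cosine and sine of the angle from the tangent at the [i]-th point to the
   chord from the [i]-th to the [j]-th point. *)
Definition cosT i j u :=
  (dX i j u * X1 (u ord0 i) + dY i j u * Y1 (u ord0 i)) / len i j u.
Definition sinT i j u :=
  (dY i j u * X1 (u ord0 i) - dX i j u * Y1 (u ord0 i)) / len i j u.

Lemma dXC i j u : dX j i u = - dX i j u. Proof. by rewrite /dX opprB. Qed.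
Lemma dYC i j u : dY j i u = - dY i j u. Proof. by rewrite /dY opprB. Qed.

Lemma lenC i j u : len j i u = len i j u.
Proof. by rewrite /len dXC dYC !mulrNN. Qed.

Lemma len_sqr i j u :
  len i j u ^+ 2 = dX i j u * dX i j u + dY i j u * dY i j u.
Proof. by rewrite sqr_sqrtr// addr_ge0// -expr2 sqr_ge0. Qed.

Lemma dX_sqr_gt0 i j u : 0 < len i j u ->
  0 < dX i j u * dX i j u + dY i j u * dY i j u.
Proof. by rewrite sqrtr_gt0. Qed.

Lemma dXE i j u : 0 < len i j u -> dX i j u =
  len i j u * (cosT i j u * X1 (u ord0 i) - sinT i j u * Y1 (u ord0 i)).
Proof.
move=> L0; rewrite /cosT /sinT.
transitivity (dX i j u * (X1 (u ord0 i) * X1 (u ord0 i) + Y1 (u ord0 i) * Y1 (u ord0 i))).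
  by rewrite speed1 mulr1.
by field; rewrite gt_eqF.
Qed.

Lemma dYE i j u : 0 < len i j u -> dY i j u =
  len i j u * (cosT i j u * Y1 (u ord0 i) + sinT i j u * X1 (u ord0 i)).
Proof.
move=> L0; rewrite /cosT /sinT.
transitivity (dY i j u * (X1 (u ord0 i) * X1 (u ord0 i) + Y1 (u ord0 i) * Y1 (u ord0 i))).
  by rewrite speed1 mulr1.
by field; rewrite gt_eqF.
Qed.

Lemma cosT_sinT_sqr i j u : 0 < len i j u -> cosT i j u ^+ 2 + sinT i j u ^+ 2 = 1.
Proof.
move=> L0; have e : len i j u ^+ 2 != 0 by rewrite gt_eqF// exprn_gt0.
apply: (mulIf e); rewrite mul1r [RHS]len_sqr -[RHS]mulr1 -(speed1 (u ord0 i)).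
by rewrite /cosT /sinT; field; rewrite gt_eqF.
Qed.

Lemma tangent_dot i j u : 0 < len i j u ->
  X1 (u ord0 i) * X1 (u ord0 j) + Y1 (u ord0 i) * Y1 (u ord0 j) =
  - (cosT i j u * cosT j i u + sinT i j u * sinT j i u).
Proof.
move=> L0; have L2 := len_sqr i j u.
rewrite /cosT /sinT (lenC i j) (dXC i j) (dYC i j).
have e : len i j u ^+ 2 != 0 by rewrite gt_eqF// exprn_gt0.
apply: (mulIf e); rewrite {1}L2; field.
by rewrite gt_eqF.
Qed.

Lemma tangent_cross i j u : 0 < len i j u ->
  X1 (u ord0 i) * Y1 (u ord0 j) - Y1 (u ord0 i) * X1 (u ord0 j) =
  cosT i j u * sinT j i u - sinT i j u * cosT j i u.
Proof.
move=> L0; have L2 := len_sqr i j u.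
rewrite /cosT /sinT (lenC i j) (dXC i j) (dYC i j).
have e : len i j u ^+ 2 != 0 by rewrite gt_eqF// exprn_gt0.
apply: (mulIf e); rewrite {1}L2; field.
by rewrite gt_eqF.
Qed.

Lemma chordE i j u (L : R) (v : R * R) : 0 < L -> dotp v v = 1 ->
  X (u ord0 j) = X (u ord0 i) + L * v.1 ->
  Y (u ord0 j) = Y (u ord0 i) + L * v.2 ->
  [/\ len i j u = L, cosT i j u = v.1 * X1 (u ord0 i) + v.2 * Y1 (u ord0 i) &
      sinT i j u = v.2 * X1 (u ord0 i) - v.1 * Y1 (u ord0 i)].
Proof.
move=> L0 v1 Xj Yj; have dXu : dX i j u = L * v.1 by rewrite /dX Xj addrAC subrr add0r.
have dYu : dY i j u = L * v.2 by rewrite /dY Yj addrAC subrr add0r.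
have lenE : len i j u = L.
  rewrite /len dXu dYu; have -> : L * v.1 * (L * v.1) + L * v.2 * (L * v.2) =
    L ^+ 2 * dotp v v by rewrite /dotp; ring.
  by rewrite v1 mulr1 sqrtr_sqr gtr0_norm.
by split=> //; rewrite /cosT /sinT lenE dXu dYu; field; rewrite gt_eqF.
Qed.

Lemma strict_grad_dX i j z : strict_grad (dX i j) z
  (fun k => (k == j)%:R * X1 (z ord0 j) - (k == i)%:R * X1 (z ord0 i)).
Proof.
exact: (strict_gradD (strict_grad_comp_coord (sX _))
  (strict_gradN (strict_grad_comp_coord (sX _)))).
Qed.

Lemma strict_grad_dY i j z : strict_grad (dY i j) z
  (fun k => (k == j)%:R * Y1 (z ord0 j) - (k == i)%:R * Y1 (z ord0 i)).
Proof.
exact: (strict_gradD (strict_grad_comp_coord (sY _))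
  (strict_gradN (strict_grad_comp_coord (sY _)))).
Qed.

(** First variation of length: an endpoint moving at unit speed changes the chord at the rate of
    minus the cosine. The perimeter is thus critical when the two cosines at each vertex cancel. *)
Lemma strict_grad_len i j z : 0 < len i j z -> strict_grad (len i j) z
  (fun k => - ((k == i)%:R * cosT i j z + (k == j)%:R * cosT j i z)).
Proof.
move=> L0; have gX := strict_grad_dX i j z; have gY := strict_grad_dY i j z.
apply: strict_grad_ext (strict_grad_comp (strict_der_sqrt (dX_sqr_gt0 L0))
  (strict_gradD (strict_gradM gX gX) (strict_gradM gY gY))) => k.
rewrite -/(len i j z) /cosT (lenC i j) (dXC i j) (dYC i j); field.
by rewrite gt_eqF.
Qed.

Lemma strict_grad_cosT i j z : 0 < len i j z -> strict_grad (cosT i j) z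
  (fun k => (k == i)%:R *
     (curvature (z ord0 i) * sinT i j z - sinT i j z ^+ 2 / len i j z)
   - (k == j)%:R * (sinT i j z * sinT j i z / len i j z)).
Proof.
move=> L0; have gX := strict_grad_dX i j z; have gY := strict_grad_dY i j z.
have gX1 := strict_grad_comp_coord (sX1 (z ord0 i)).
have gY1 := strict_grad_comp_coord (sY1 (z ord0 i)).
have L0' : len i j z != 0 by rewrite gt_eqF.
have gV := strict_grad_comp (strict_der_inv L0') (strict_grad_len L0).
apply: strict_grad_ext (strict_gradM
  (strict_gradD (strict_gradM gX gX1) (strict_gradM gY gY1)) gV) => k /=.
have [x2 y2] := acceleration (z ord0 i); rewrite x2 y2.
have tt := tangent_dot L0; have cs := cosT_sinT_sqr L0.
have u := speed1 (z ord0 i).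
have eS : dY i j z * X1 (z ord0 i) - dX i j z * Y1 (z ord0 i) = sinT i j z * len i j z.
  by rewrite /sinT divfK.
have eC : dX i j z * X1 (z ord0 i) + dY i j z * Y1 (z ord0 i) = cosT i j z * len i j z.
  by rewrite /cosT divfK.
rewrite eC.
(* The raw derivative is regrouped into dot products of tangents and the normal part of the chord,
   which are known in terms of the angles. *)
transitivity (((k == j)%:R *
    (X1 (z ord0 i) * X1 (z ord0 j) + Y1 (z ord0 i) * Y1 (z ord0 j))
  - (k == i)%:R * (X1 (z ord0 i) * X1 (z ord0 i) + Y1 (z ord0 i) * Y1 (z ord0 i))
  + (k == i)%:R * curvature (z ord0 i) *
    (dY i j z * X1 (z ord0 i) - dX i j z * Y1 (z ord0 i))) / len i j z
  + cosT i j z / len i j z * ((k == i)%:R * cosT i j z + (k == j)%:R * cosT j i z)).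
  by field.
rewrite tt u eS -cs; field.
by [].
Qed.

Lemma strict_grad_sinT i j z : 0 < len i j z -> strict_grad (sinT i j) z
  (fun k => (k == i)%:R *
     (sinT i j z * cosT i j z / len i j z - curvature (z ord0 i) * cosT i j z)
   + (k == j)%:R * (cosT i j z * sinT j i z / len i j z)).
Proof.
move=> L0; have gX := strict_grad_dX i j z; have gY := strict_grad_dY i j z.
have gX1 := strict_grad_comp_coord (sX1 (z ord0 i)).
have gY1 := strict_grad_comp_coord (sY1 (z ord0 i)).
have L0' : len i j z != 0 by rewrite gt_eqF.
have gV := strict_grad_comp (strict_der_inv L0') (strict_grad_len L0).
apply: strict_grad_ext (strict_gradM
  (strict_gradD (strict_gradM gY gX1) (strict_gradN (strict_gradM gX gY1))) gV) => k /=.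
have [x2 y2] := acceleration (z ord0 i); rewrite x2 y2.
have tc := tangent_cross L0.
have eS : dY i j z * X1 (z ord0 i) - dX i j z * Y1 (z ord0 i) = sinT i j z * len i j z.
  by rewrite /sinT divfK.
have eC : dX i j z * X1 (z ord0 i) + dY i j z * Y1 (z ord0 i) = cosT i j z * len i j z.
  by rewrite /cosT divfK.
rewrite eS.
transitivity (((k == j)%:R *
    (X1 (z ord0 i) * Y1 (z ord0 j) - Y1 (z ord0 i) * X1 (z ord0 j))
  - (k == i)%:R * curvature (z ord0 i) *
    (dX i j z * X1 (z ord0 i) + dY i j z * Y1 (z ord0 i))) / len i j z
  + sinT i j z / len i j z * ((k == i)%:R * cosT i j z + (k == j)%:R * cosT j i z)).
  by field.
rewrite tc eC; field.
by [].
Qed.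

(** The only place where third derivatives enter. The value [d] stays abstract: what matters later
    is that the gradient vanishes in the other coordinates. *)
Lemma strict_grad_curvature i z : exists d,
  strict_grad (fun u => curvature (u ord0 i)) z (fun k => (k == i)%:R * d).
Proof.
have gX1 := strict_grad_comp_coord (sX1 (z ord0 i)).
have gY1 := strict_grad_comp_coord (sY1 (z ord0 i)).
have gX2 := strict_grad_comp_coord (sX2 (z ord0 i)).
have gY2 := strict_grad_comp_coord (sY2 (z ord0 i)).
eexists; apply: strict_grad_ext (strict_gradD (strict_gradM gX1 gY2)
  (strict_gradN (strict_gradM gY1 gX2))) => k.
set b := (k == i)%:R.
transitivity (b * (X2 (z ord0 i) * Y2 (z ord0 i) + X1 (z ord0 i) * Y3 (z ord0 i)
 - (Y2 (z ord0 i) * X2 (z ord0 i) + Y1 (z ord0 i) * X3 (z ord0 i)))); first by ring.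
by [].
Qed.

End Gradients.

(** * Critical triangles of the perimeter *)

Section Triangles.
Implicit Types (u v z : 'rV[R]_3) (s : R).

Let neq3 : ((i0 == i1) = false) * ((i0 == i2) = false) * ((i1 == i0) = false) *
  ((i1 == i2) = false) * ((i2 == i0) = false) * ((i2 == i1) = false).
Proof. by []. Qed.

(** The cosine equations say that the perimeter is critical; the sine equations add that both sides
    at a vertex lie on the same side of its tangent. *)
Record bounce_triangle z : Prop := BounceTriangle {
  side01 : 0 < len i0 i1 z;
  side02 : 0 < len i0 i2 z;
  side12 : 0 < len i1 i2 z;
  reflect_cos0 : cosT i0 i1 z + cosT i0 i2 z = 0;
  reflect_cos1 : cosT i1 i0 z + cosT i1 i2 z = 0;
  reflect_cos2 : cosT i2 i0 z + cosT i2 i1 z = 0;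
  reflect_sin0 : sinT i0 i2 z = sinT i0 i1 z;
  reflect_sin1 : sinT i1 i2 z = sinT i1 i0 z;
  reflect_sin2 : sinT i2 i1 z = sinT i2 i0 z;
  transversal0 : sinT i0 i1 z != 0;
  transversal1 : sinT i1 i0 z != 0;
  transversal2 : sinT i2 i0 z != 0;
  nondegenerate0 : cosT i0 i1 z != 0 }.

Definition perimeter z := len i0 i1 z + len i0 i2 z + len i1 i2 z.

(* At a bounce triangle, zero exactly when the Hessian of the perimeter has rank
   one. *)
Definition defect z :=
  curvature (z ord0 i0) * perimeter z - 2 * sinT i0 i1 z ^+ 3.

(** In the frame at [i0] the two sides have directions [(c, s)] and [(- c, s)], with dot product
    [s ^ 2 - c ^ 2 = 2 * s ^ 2 - 1]; the rest is the law of cosines. *)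
Lemma bounce_law_of_cosines z : bounce_triangle z ->
  (len i0 i1 z + len i0 i2 z) ^+ 2 - len i1 i2 z ^+ 2 =
  4 * sinT i0 i1 z ^+ 2 * len i0 i1 z * len i0 i2 z.
Proof.
move=> H; have cs := cosT_sinT_sqr (side01 H).
have dX12 : dX i1 i2 z = dX i0 i2 z - dX i0 i1 z by rewrite /dX; ring.
have dY12 : dY i1 i2 z = dY i0 i2 z - dY i0 i1 z by rewrite /dY; ring.
have c02 : cosT i0 i2 z = - cosT i0 i1 z.
  by apply/eqP; rewrite -addr_eq0 addrC (reflect_cos0 H).
rewrite (len_sqr i1 i2) dX12 dY12 (dXE (side01 H)) (dYE (side01 H)).
rewrite (dXE (side02 H)) (dYE (side02 H)) c02 (reflect_sin0 H).
have u := speed1 (z ord0 i0); move: cs u.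
move: (len i0 i1 z) (len i0 i2 z) (cosT i0 i1 z) (sinT i0 i1 z) (X1 _) (Y1 _).
move=> a b c s x y cs u.
transitivity ((a + b) ^+ 2 * (c ^+ 2 + s ^+ 2) -
  (x * x + y * y) * (c ^+ 2 * (a + b) ^+ 2 + s ^+ 2 * (a - b) ^+ 2)).
  by rewrite cs mulr1; ring.
by rewrite u; ring.
Qed.

(** The perimeter is stationary, and neither the curvature at [i0] nor [sinT i0 i1] depends on the
    third point. In the direction [i1] only the cube of the sine contributes. *)
Lemma strict_grad_defect z : bounce_triangle z -> exists g,
  [/\ strict_grad defect z g, g i2 = 0 &
    g i1 = - 6 * sinT i0 i1 z ^+ 2 * cosT i0 i1 z * sinT i1 i0 z / len i0 i1 z].
Proof.
move=> H; have [d gk] := strict_grad_curvature i0 z.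
have gP := strict_gradD (strict_gradD (strict_grad_len (side01 H))
  (strict_grad_len (side02 H))) (strict_grad_len (side12 H)).
have gS := strict_grad_sinT (side01 H).
have gS3 := strict_gradM (strict_grad_cst 2 z) (strict_gradM gS (strict_gradM gS gS)).
have gD := strict_gradD (strict_gradM gk gP) (strict_gradN gS3).
have c1 : cosT i1 i2 z = - cosT i1 i0 z.
  by apply/eqP; rewrite -addr_eq0 addrC (reflect_cos1 H).
have c2 : cosT i2 i1 z = - cosT i2 i0 z.
  by apply/eqP; rewrite -addr_eq0 addrC (reflect_cos2 H).
eexists; split; first exact: gD.
  by cbv beta; rewrite !(eqxx, neq3) c2 mulr1n mulr0n; ring.
by cbv beta; rewrite !(eqxx, neq3) c1 mulr1n mulr0n; ring.
Qed.

Lemma sum3 (i j k : 'I_3) (G : 'I_3 -> R) : uniq [:: i; j; k] ->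
  \sum_m G m = G i + G j + G k.
Proof.
move=> uq; rewrite (bigD1 i)//= (bigD1 j)/=; last first.
  by move: uq; rewrite /= !inE negb_or eq_sym => /andP[/andP[]].
rewrite (bigD1 k)/=; last first.
  by move: uq; rewrite /= !inE negb_or ![k == _]eq_sym => /and3P[/andP[_ ->] ->].
rewrite big1 ?addr0 ?addrA// => m.
by move: i j k m uq; do 4![case=> [[|[|[|//]]] ?]].
Qed.

Context (F1 F2 : 'rV[R]_3 -> R).
Context (hF : forall z, bounce_triangle z ->
  exists c1 c2, strict_grad F1 z c1 /\ strict_grad F2 z c2).

Lemma bounce_null s : 1 < s ->
  hausdorff_null s ((fun u => (F1 u, F2 u)) @` bounce_triangle).
Proof.
move=> s1.
pose E0 := [set u | bounce_triangle u /\ defect u = 0].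
pose E1 := [set u | bounce_triangle u /\ defect u != 0].
apply: (@hausdorff_null_subset _ _ _ (\bigcup_m
    (if m is 0%N then (fun u => (F1 u, F2 u)) @` E0 else (fun u => (F1 u, F2 u)) @` E1))).
  move=> _ [u Hu <-]; have [d0|d0] := eqVneq (defect u) 0.
    by exists 0%N => //; exists u.
  by exists 1%N => //; exists u.
apply: hausdorff_null_bigcup => -[|_]; apply: hausdorff_null_local_graph => //.
- move=> z [H d0]; have [c1 [c2 [gF1 gF2]]] := hF H.
  have [g [gd g2 g1]] := strict_grad_defect H.
  have gG := strict_gradD (strict_grad_cosT (side01 H)) (strict_grad_cosT (side02 H)).
  have [||U zU [K h]] :=
    @strict_grad_graph _ _ i0 i1 i2 _ _ _ _ _ F1 F2 c1 c2 _ gG gd _ gF1 gF2.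
  + by move=> G; apply: sum3.
  + rewrite g1 g2; cbv beta; rewrite !(eqxx, neq3) mulr1n mulr0n (reflect_sin0 H).
    have p1 := side01 H; have p2 := side02 H.
    (* As [g i2 = 0], the determinant is minus the product of [g i1] and the [i2]-derivative of the
       cosine sum at [i0]. *)
    rewrite [X in X != 0](_ : _ = - (6 * sinT i0 i1 z ^+ 3 * cosT i0 i1 z *
      sinT i1 i0 z * sinT i2 i0 z / (len i0 i1 z * len i0 i2 z))); last first.
      by field; rewrite !gt_eqF.
    move: (transversal0 H) (transversal1 H) (transversal2 H) (nondegenerate0 H).
    move: p1 p2 => /lt0r_neq0 + /lt0r_neq0.
    move: (sinT _ _ _) (sinT _ _ _) (sinT _ _ _) (cosT _ _ _) (len _ _ _) (len _ _ _).
    move=> a b c x p q p0 q0 a0 b0 c0 x0.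
    rewrite oppr_eq0 !mulf_neq0 ?invr_eq0 ?mulf_neq0 ?expf_neq0 ?pnatr_eq0//.
  + exists U => //; exists i0, K => u v [Hu du] Uu [Hv dv] Uv.
    apply: h => //; first by rewrite /= (reflect_cos0 Hu) (reflect_cos0 Hv).
    by rewrite du dv.
- move=> z [H d0]; have [c1 [c2 [gF1 gF2]]] := hF H.
  have p10 : 0 < len i1 i0 z by rewrite (lenC i0 i1) (side01 H).
  have gG0 := strict_gradD (strict_grad_cosT (side01 H)) (strict_grad_cosT (side02 H)).
  have gG1 := strict_gradD (strict_grad_cosT p10) (strict_grad_cosT (side12 H)).
  have [||U zU [K h]] :=
    @strict_grad_graph _ _ i1 i0 i2 _ _ _ _ _ F1 F2 c1 c2 _ gG0 gG1 _ gF1 gF2.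
  + by move=> G; apply: sum3.
  + cbv beta; rewrite !(eqxx, neq3) mulr1n mulr0n (lenC i0 i1).
    rewrite (reflect_sin0 H) (reflect_sin1 H) (reflect_sin2 H).
    have p1 := side01 H; have p2 := side02 H; have p12 := side12 H.
    have law := bounce_law_of_cosines H.
    apply: contraNneq d0 => m0.
    (* A vanishing minor would force a vanishing defect, since the left side equals the minor times
       the perimeter and the three lengths. *)
    have : - 2 * (sinT i0 i1 z * sinT i1 i0 z * sinT i2 i0 z *
        (len i0 i1 z * len i0 i2 z)) * defect z = 0.
      transitivity (- (sinT i0 i1 z * sinT i1 i0 z * sinT i2 i0 z) *
        (2 * curvature (z ord0 i0) * perimeter z * len i0 i1 z * len i0 i2 z -
         sinT i0 i1 z * (4 * sinT i0 i1 z ^+ 2 * len i0 i1 z * len i0 i2 z))).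
        by rewrite /defect; ring.
      (* The law of cosines makes the sine term a difference of squares, hence divisible by the
         perimeter. *)
      rewrite -law -[RHS](mul0r (perimeter z * len i0 i1 z * len i0 i2 z * len i1 i2 z)).
      rewrite -m0 /perimeter; field.
      by rewrite !gt_eqF.
    move/eqP; rewrite mulf_eq0 => /orP[|//]; apply: contraLR => _.
    move: (transversal0 H) (transversal1 H) (transversal2 H).
    move: p1 p2 => /lt0r_neq0 + /lt0r_neq0.
    move: (sinT _ _ _) (sinT _ _ _) (sinT _ _ _) (len _ _ _) (len _ _ _).
    move=> a b c p q p0 q0 a0 b0 c0.
    by rewrite !mulf_neq0// oppr_eq0 pnatr_eq0.
  + exists U => //; exists i1, K => u v [Hu du] Uu [Hv dv] Uv.
    apply: h => //; first by rewrite /= (reflect_cos0 Hu) (reflect_cos0 Hv).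
    by rewrite /= (reflect_cos1 Hu) (reflect_cos1 Hv).
Qed.

End Triangles.
End Chords.

(** * Three-periodic orbits *)

Section ThreePeriodic.
Context {R : realType} {l : R} {gamma : R -> R * R} {D : set (R * R)}.
Context (hD : billiard l gamma D) (hC : class_C_curve 3 gamma).

Local Notation X := (fst \o gamma).
Local Notation Y := (snd \o gamma).
Local Notation X1 := (derive1n 1 (fst \o gamma)).
Local Notation Y1 := (derive1n 1 (snd \o gamma)).
Local Notation bounce := (@bounce_triangle R X Y X1 Y1).
Local Notation cosT := (@cosT R X Y X1 Y1 3).
Local Notation sinT := (@sinT R X Y X1 Y1 3).

Definition normal_part (t : R) (v : R * R) := v.2 * X1 t - v.1 * Y1 t.

Lemma normal_part_reflection t v :
  normal_part t (reflection (tangent gamma t) v) = - normal_part t v.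
Proof.
rewrite /normal_part /reflection /dotp /=.
move: (derive1 X t) (derive1 Y t) (v.1) (v.2) => a b c d.
by rewrite /GRing.scale /=; ring.
Qed.

Lemma dotp_reflection t v :
  dotp (reflection (tangent gamma t) v) (tangent gamma t) = dotp v (tangent gamma t).
Proof.
have := unit_speed hD t; rewrite /reflection /dotp /=.
move: (derive1 X t) (derive1 Y t) (v.1) (v.2) => a b c d h; rewrite /GRing.scale /=.
transitivity ((c * a + d * b) * (2 * (a * a + b * b) - 1)); first by ring.
by rewrite h; ring.
Qed.

(** The square of the normal component is the squared sine of an angle in []0, pi[]. *)
Lemma outgoing_normal_neq0 p v : outgoing gamma D p v -> normal_part p.1 v != 0.
Proof.
move=> [/andP ph vv vT _].
have [n vE n2] := frame_decomposition hD vv vT.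
have -> : normal_part p.1 v = n.
  have := unit_speed hD p.1; rewrite /normal_part vE /frame /=.
  move: (derive1 X p.1) (derive1 Y p.1) => a b h.
  by transitivity (n * (a * a + b * b)); [ring|rewrite h mulr1].
have : n ^+ 2 != 0 by rewrite n2 -sin2cos2 expf_eq0 /= gt_eqF// sin_gt0_pi// in_itv.
by rewrite expf_eq0.
Qed.

Lemma period3_bounce p : period3 gamma D p ->
  exists2 z, bounce z & p = (z ord0 i0, acos (cosT i0 i1 z)).
Proof.
move=> [q [r [[v1 [L1 [out1 L10 g1 f1 out1']]] [v2 [L2 [out2 L20 g2 f2 out2']]]
  [v3 [L3 [out3 L30 g3 f3 out3']]]]]].
(* At each of the three points the outgoing vector is the reflection of the incoming one. *)
have E2 := outgoing_unique hD hC out2 out1'.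
have E3 := outgoing_unique hD hC out3 out2'.
have E1 := outgoing_unique hD hC out1 out3'.
pose z : 'rV[R]_3 := \row_(k < 3) nth 0 [:: p.1; q.1; r.1] k.
have z0 : z ord0 i0 = p.1 by rewrite mxE.
have z1 : z ord0 i1 = q.1 by rewrite mxE.
have z2 : z ord0 i2 = r.1 by rewrite mxE.
have chord i j a b L v : z ord0 i = a -> z ord0 j = b -> 0 < L -> dotp v v = 1 ->
    gamma b = gamma a + L *: v ->
    [/\ @len R X Y 3 i j z = L, cosT i j z = dotp v (tangent gamma a),
        sinT i j z = normal_part a v,
        cosT j i z = - dotp v (tangent gamma b) &
        sinT j i z = - normal_part b v].
  move=> <- <- L0 vv g.
  have vv' : dotp (- v) (- v) = 1 by rewrite -vv /dotp /= !mulrNN.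
  have [] := @chordE R X Y X1 Y1 3 i j z L v L0 vv; rewrite /= ?g//.
  have [] := @chordE R X Y X1 Y1 3 j i z L (- v) L0 vv';
    rewrite /= ?g /= ?mulrN ?addrK//.
  move=> _ c' s' lE c s; split=> //; rewrite ?c' ?s' /dotp /normal_part /=.
    by rewrite !mulNr opprD.
  by rewrite !mulNr opprD.
have [_ vv1 vT1 _] := out1; have [_ vv2 _ _] := out2; have [_ vv3 _ _] := out3.
have [l01 c01 s01 c10 s10] := chord _ _ _ _ _ _ z0 z1 L10 vv1 g1.
have [l12 c12 s12 c21 s21] := chord _ _ _ _ _ _ z1 z2 L20 vv2 g2.
have [l20 c20 s20 c02 s02] := chord _ _ _ _ _ _ z2 z0 L30 vv3 g3.
(* At a right angle the orbit returns along its own line, so [q] and [r] lie on one ray from [p].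
   Then the nearer one interrupts the side to the farther one, or they coincide and the middle side
   has length zero. *)
have c01n0 : dotp v1 (tangent gamma p.1) != 0.
  apply/eqP => c0.
  have v13 : v1 = - v3.
    have := E1; rewrite /reflection.
    by rewrite -(dotp_reflection p.1 v3) -E1 c0 mulr0 scale0r sub0r.
  have g3' : gamma r.1 = gamma p.1 + L3 *: v1.
    by rewrite g3 v13 scalerN addrK.
  have [lt|gt|eq] := ltgtP L1 L3.
  - apply: (f3 (L3 - L1)); rewrite ?subr_gt0// ?gtrBl//.
    exists q.1 => //; have -> : v3 = - v1 by rewrite v13 opprK.
    rewrite g1 g3' scalerN -scaleNr opprB -addrA -scalerDl.
    by rewrite [L3 + _]addrC subrK.
  - by apply: (f1 L3) => //; exists r.1.
  - have : L2 *: v2 = 0.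
      by apply: (addrI (gamma q.1)); rewrite -g2 g3' g1 eq addr0.
    move/eqP; rewrite scaler_eq0 (gt_eqF L20) /= => /eqP v20.
    by move: vv2; rewrite v20 /dotp /= !mul0r addr0 => /eqP; rewrite eq_sym oner_eq0.
exists z.
  split.
  - by rewrite l01.
  - by rewrite lenC l20.
  - by rewrite l12.
  - by rewrite c01 c02 E1 dotp_reflection subrr.
  - by rewrite c10 c12 E2 dotp_reflection addNr.
  - by rewrite c20 c21 E3 dotp_reflection subrr.
  - by rewrite s01 s02 [in RHS]E1 normal_part_reflection.
  - by rewrite s10 s12 E2 normal_part_reflection.
  - by rewrite s20 s21 E3 normal_part_reflection.
  - by rewrite s01; exact: outgoing_normal_neq0 out1.
  - by rewrite s10 -normal_part_reflection -E2; exact: outgoing_normal_neq0 out2.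
  - by rewrite s20; exact: outgoing_normal_neq0 out3.
  - by rewrite c01.
have [[ph1 ph2] _ _ _] := out1.
rewrite z0 c01 vT1 cosK; first by case: (p).
by rewrite in_itv /= !ltW.
Qed.

Lemma period3_null s : 1 < s ->
  hausdorff_null s (annulus_embedding l @` period3 gamma D).
Proof.
move=> s1.
pose F1 (u : 'rV[R]_3) := (1 + acos (cosT i0 i1 u)) * cos (2 * pi * u ord0 i0 / l).
pose F2 (u : 'rV[R]_3) := (1 + acos (cosT i0 i1 u)) * sin (2 * pi * u ord0 i0 / l).
apply: (@hausdorff_null_subset _ _ _ ((fun u => (F1 u, F2 u)) @` bounce)).
  by move=> _ [p /period3_bounce[z Hz ->] <-]; exists z.
have sX := fun t => @class_C_strict R X 3 0 t hC.1 isT.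
have sY := fun t => @class_C_strict R Y 3 0 t hC.2 isT.
have sX1 := fun t => @class_C_strict R X 3 1 t hC.1 isT.
have sY1 := fun t => @class_C_strict R Y 3 1 t hC.2 isT.
have sX2 := fun t => @class_C_strict R X 3 2 t hC.1 isT.
have sY2 := fun t => @class_C_strict R Y 3 2 t hC.2 isT.
apply: (bounce_null sX sY sX1 sY1 sX2 sY2 (unit_speed hD)
  (acceleration_orthogonal hD hC)) s1 => z; rewrite -/(bounce z) => H.
have gC := strict_grad_cosT sX sY sX1 sY1 (unit_speed hD)
  (acceleration_orthogonal hD hC) (side01 H).
have cs : cosT i0 i1 z ^+ 2 + sinT i0 i1 z ^+ 2 = 1.
  exact: (cosT_sinT_sqr (unit_speed hD) (side01 H)).
(* Transversality keeps the cosine away from the endpoints, where [acos] is not differentiable. *)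
have c1 : -1 < cosT i0 i1 z < 1.
  have : 0 < sinT i0 i1 z ^+ 2.
    by rewrite exprn_even_gt0//=; exact: (transversal0 H).
  move: cs; move: (cosT _ _ _) (sinT _ _ _) => c x cs x2.
  by apply/andP; split; nra.
have gA := strict_gradD (strict_grad_cst 1 z) (strict_grad_comp (strict_der_acos c1) gC).
have gT := strict_gradM (strict_gradM (strict_grad_cst (2 * pi) z) (strict_grad_coord i0 z))
  (strict_grad_cst l^-1 z).
have dcos t : strict_der (@cos R) t (- sin t).
  apply: (@strict_der_C1 _ _ (fun t => - sin t)).
    by near=> u; exact: is_derive_cos.
  by apply: cvgN; exact: continuous_sin.
have dsin t : strict_der (@sin R) t (cos t).
  apply: (@strict_der_C1 _ _ cos); last exact: continuous_cos.
  by near=> u; exact: is_derive_sin.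
eexists; eexists; split.
  exact: (strict_gradM gA (strict_grad_comp (dcos _) gT)).
exact: (strict_gradM gA (strict_grad_comp (dsin _) gT)).
Unshelve. all: by end_near. Qed.

End ThreePeriodic.

Theorem theorem1p1 (R : realType) (l : R) (gamma : R -> R * R)
    (D : set (R * R)) (hD : billiard l gamma D) (hC3 : class_C_curve 3 gamma) :
  let P3 := annulus_embedding l @` period3 gamma D in
  (exists2 s0 : R, is_hausdorff_dim P3 s0 & s0 <= 1) /\
  (forall s : R, 1 < s -> hausdorff_measure s P3 = 0%E).
Proof.
move=> P3; have nP3 s : 1 < s -> hausdorff_null s P3 by exact: period3_null.
split; first exact: hausdorff_dim_le1.
by move=> s /nP3; exact: hausdorff_measure_null.
Qed.
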